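(* Let $G$ be a nontrivial torsion-free compact abelian group. Then every nonempty subset of $\widehat{G}$ is ubiquitous, but no finite subset of $\widehat{G}$ is strictly positive definite.
   Context: A trigonometric polynomial on $\widehat{G}$ is a function of the form $\gamma \mapsto \sum_{i=1}^n c_i \gamma(x_i)$ with $x_i \in G$, $c_i \in \mathbb{C}$. A subset $K \subset \widehat{G}$ is strictly positive definite if the only trigonometric polynomial on $\widehat{G}$ vanishing at every point of $K$ is the identically zero function. A subset $K \subset \widehat{G}$ is ubiquitous if for every subgroup $H$ of $\widehat{G}$ of finite index and every $\gamma \in \widehat{G}$ the coset $\gamma H$ meets $K$. *)

(* Defs.v *)
From Stdlib Require Import Reals List.
Import ListNotations.
Open Scope R_scope.

Definition C : Type := (R * R)%type.
Definition C0 : C := (0, 0).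
Definition C1 : C := (1, 0).
Definition Cadd (z w : C) : C := (fst z + fst w, snd z + snd w).
Definition Cmul (z w : C) : C :=
  (fst z * fst w - snd z * snd w, fst z * snd w + snd z * fst w).
Definition Cnorm2 (z : C) : R := fst z * fst z + snd z * snd z.
Definition Cdist2 (z w : C) : R := Cnorm2 (fst z - fst w, snd z - snd w).

Record TopAbGroup := mkTopAbGroup {
  tg_car :> Type;
  tg_add : tg_car -> tg_car -> tg_car;
  tg_opp : tg_car -> tg_car;
  tg_zero : tg_car;
  tg_open : (tg_car -> Prop) -> Prop
}.

Section Defs.
Variable G : TopAbGroup.
Local Notation "x + y" := (tg_add G x y).
Local Notation "- x" := (tg_opp G x).
Local Notation "0" := (tg_zero G).
Local Notation opn := (tg_open G).

Definition is_abelian_group : Prop :=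
  (forall x y z : G, x + (y + z) = (x + y) + z) /\
  (forall x y : G, x + y = y + x) /\
  (forall x : G, x + 0 = x) /\
  (forall x : G, x + (- x) = 0).

Definition is_topology : Prop :=
  opn (fun _ => True) /\ opn (fun _ => False) /\
  (forall U V, opn U -> opn V -> opn (fun x => U x /\ V x)) /\
  (forall (I : Type) (U : I -> G -> Prop),
      (forall i, opn (U i)) -> opn (fun x => exists i, U i x)).

Definition sub_continuous : Prop :=
  forall (x y : G) (W : G -> Prop), opn W -> W (x + - y) ->
  exists U V, opn U /\ opn V /\ U x /\ V y /\
    (forall u v, U u -> V v -> W (u + - v)).

Definition hausdorff : Prop :=
  forall x y : G, x <> y -> exists U V, opn U /\ opn V /\ U x /\ V y /\
    (forall z, U z -> V z -> False).

Definition compact : Prop :=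
  forall (I : Type) (U : I -> G -> Prop),
    (forall i, opn (U i)) -> (forall x, exists i, U i x) ->
    exists l : list I, forall x, exists i, In i l /\ U i x.

Definition is_compact_abelian_group : Prop :=
  is_abelian_group /\ is_topology /\ sub_continuous /\ hausdorff /\ compact.

Fixpoint nsmul (n : nat) (x : G) : G :=
  match n with O => 0 | S m => x + nsmul m x end.

Definition torsion_free : Prop :=
  forall (n : nat) (x : G), (0 < n)%nat -> nsmul n x = 0 -> x = 0.

Definition nontrivial : Prop := exists x : G, x <> 0.

Definition continuous_to_C (f : G -> C) : Prop :=
  forall (x : G) (eps : R), 0 < eps ->
  exists U, opn U /\ U x /\ forall y, U y -> Cdist2 (f y) (f x) < eps.

Definition is_character (g : G -> C) : Prop :=
  (forall x, Cnorm2 (g x) = 1) /\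
  (forall x y, g (x + y) = Cmul (g x) (g y)) /\
  continuous_to_C g.

Definition dual : Type := { g : G -> C | is_character g }.

Definition dual_mul_rel (a b c : dual) : Prop :=
  forall x, proj1_sig c x = Cmul (proj1_sig a x) (proj1_sig b x).

Definition dual_is_one (a : dual) : Prop := forall x, proj1_sig a x = C1.

Definition dual_inv_rel (a b : dual) : Prop :=
  forall c, dual_mul_rel a b c -> dual_is_one c.

Definition is_subgroup (H : dual -> Prop) : Prop :=
  (forall e, dual_is_one e -> H e) /\
  (forall a b c, H a -> H b -> dual_mul_rel a b c -> H c) /\
  (forall a b, H a -> dual_inv_rel a b -> H b).

Definition finite_index (H : dual -> Prop) : Prop :=
  exists l : list dual, forall gam,
    exists g h, In g l /\ H h /\ dual_mul_rel g h gam.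

Definition coset_meets (gam : dual) (H K : dual -> Prop) : Prop :=
  exists h c, H h /\ dual_mul_rel gam h c /\ K c.

Definition ubiquitous (K : dual -> Prop) : Prop :=
  forall H : dual -> Prop, is_subgroup H -> finite_index H ->
  forall gam : dual, coset_meets gam H K.

(** trigonometric polynomial gam |-> sum_i c_i gam(x_i), given by [(c_i,x_i)] *)
Definition trig_eval (p : list (C * G)) (gam : dual) : C :=
  fold_right (fun cx acc => Cadd (Cmul (fst cx) (proj1_sig gam (snd cx))) acc) C0 p.

Definition strictly_positive_definite (K : dual -> Prop) : Prop :=
  forall p : list (C * G),
    (forall gam, K gam -> trig_eval p gam = C0) ->
    forall gam, trig_eval p gam = C0.

Definition finite_subset (K : dual -> Prop) : Prop :=
  exists l : list dual, forall gam, K gam -> In gam l.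

End Defs.

(* Main.v *)
Require Import Defs.
From Stdlib Require Import Reals List.
From Stdlib Require Import Lra Lia Factorial Classical ClassicalEpsilon.
From Stdlib Require Import FunctionalExtensionality ProofIrrelevance.
From Coquelicot Require Import Coquelicot.
Import ListNotations.
Open Scope R_scope.

(** The argument rests on completeness of characters: for a continuous [g <> 0] on a compact abelian
    group there is a character [chi] with [g * chi <> 0] (convolution with respect to the invariant
    mean). The mean of [f] is the unique constant that is uniformly approximated by averages of
    translates of [f]. For a hermitian [phi <> 0] the powers of [phi * phi], normalised by the top
    eigenvalue of the convolution operator, converge uniformly to a hermitian idempotent. A nonzero
    hermitian idempotent has value at least [1] at [0], so there are minimal ones, and translation
    multiplies a minimal idempotent by scalars: up to normalisation it is a character.

    If [G] is torsion-free, completeness applied to [h x = mean_y (g (x + n y) * conj (gam y))], with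
    a bump function [g], gives an [n]-th root of the character [gam]; thus the dual group is divisible.
    A divisible group has no proper subgroup of finite index. For a finite set [l] of characters and a
    point [x], [prod_(g in l) (gam x - g x)] is a trigonometric polynomial in [gam] that vanishes on
    [l]; it is not zero if [x] is not killed by all characters, because by divisibility [chi x] then
    takes infinitely many values. *)

(* The obstacle is to reach a spectral theorem without measure, Hilbert space or compact operators:
   everything stays among continuous functions with uniform convergence. Positivity makes this
   possible. A convolution square [f] is largest at [0], and by Cauchy-Schwarz so is [f - k ∗ f] if
   [k] is hermitian and its convolution operator is at most the identity. Hence one decreasing
   sequence of reals, the values at [0] of the powers, controls uniform convergence. Normalising by
   the exact supremum of the Rayleigh quotients keeps these values at least [1], so the limit does
   not vanish.

   Torsion-freeness enters as injectivity of [x |-> n x], which is what an [n]-th root requires. The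
   order of the roots is [fact (length l)]: the pigeonhole principle yields an exponent between [1]
   and [length l] that cannot be predicted, and the factorial is a multiple of every candidate. *)
Declare Scope ab_scope.
Delimit Scope ab_scope with ab.
Notation "x ⊕ y" := (tg_add _ x y) (at level 50, left associativity) : ab_scope.
Notation "⊖ x" := (tg_opp _ x) (at level 35, right associativity) : ab_scope.
Notation "x ⊖ y" := (tg_add _ x (tg_opp _ y)) (at level 50, left associativity) : ab_scope.
Open Scope ab_scope.

(** * Deciding identities in abelian groups by reflection *)

Inductive gexp := GV (n : nat) | GZ | GA (a b : gexp) | GO (a : gexp).

(** An expression is a formal difference of two multisets of atoms, [gpos e] minus [gneg e]. An
    equation is decided by moving the negative parts across and comparing multisets, so no integer
    coefficients occur. *)
Fixpoint gpos (e : gexp) : list nat :=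
  match e with
  | GV n => [n] | GZ => [] | GA a b => gpos a ++ gpos b | GO a => gneg a
  end
with gneg (e : gexp) : list nat :=
  match e with
  | GV n => [] | GZ => [] | GA a b => gneg a ++ gneg b | GO a => gpos a
  end.

Fixpoint remove_first (n : nat) (l : list nat) : option (list nat) :=
  match l with
  | [] => None
  | m :: l' => if Nat.eqb n m then Some l'
      else match remove_first n l' with Some r => Some (m :: r) | None => None end
  end.

Fixpoint same_elements (l1 l2 : list nat) : bool :=
  match l1 with
  | [] => match l2 with [] => true | _ => false end
  | n :: l => match remove_first n l2 with Some r => same_elements l r | None => false end
  end.

Section GroupSolver.
Variable G : TopAbGroup.
Hypothesis Hab : is_abelian_group G.

Lemma gA (x y z : G) : x ⊕ (y ⊕ z) = x ⊕ y ⊕ z.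
Proof. apply Hab. Qed.
Lemma gC (x y : G) : x ⊕ y = y ⊕ x.
Proof. apply Hab. Qed.
Lemma g0 (x : G) : x ⊕ tg_zero G = x.
Proof. apply Hab. Qed.
Lemma gN (x : G) : x ⊖ x = tg_zero G.
Proof. apply Hab. Qed.
Lemma g0l (x : G) : tg_zero G ⊕ x = x.
Proof. rewrite gC; apply g0. Qed.

Lemma g_cancel (x y z : G) : x ⊕ z = y ⊕ z -> x = y.
Proof.
  intros H. rewrite <- (g0 x), <- (g0 y), <- (gN z), !gA, H. reflexivity.
Qed.

Variable env : list G.

Fixpoint geval (e : gexp) : G :=
  match e with
  | GV n => nth n env (tg_zero G)
  | GZ => tg_zero G
  | GA a b => geval a ⊕ geval b
  | GO a => ⊖ geval a
  end.

Definition gsum (l : list nat) : G :=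
  fold_right (fun n s => nth n env (tg_zero G) ⊕ s) (tg_zero G) l.

Lemma gsum_app l1 l2 : gsum (l1 ++ l2) = gsum l1 ⊕ gsum l2.
Proof.
  induction l1 as [|n l1 IH]; simpl.
  - now rewrite g0l.
  - now rewrite IH, gA.
Qed.

Lemma g_swap (a b c d : G) : (a ⊕ b) ⊕ (c ⊕ d) = (a ⊕ c) ⊕ (b ⊕ d).
Proof. rewrite gA, <- (gA a b c), (gC b c), (gA a c b), <- gA. reflexivity. Qed.

Lemma geval_pos_neg e : geval e ⊕ gsum (gneg e) = gsum (gpos e).
Proof.
  induction e as [n| |a IHa b IHb|a IHa]; simpl.
  - now rewrite !g0.
  - now rewrite !g0.
  - rewrite !gsum_app, <- IHa, <- IHb. apply g_swap.
  - rewrite <- IHa, gA, (gC (⊖ _)), gN. apply g0l.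
Qed.

Lemma remove_first_sum n l r :
  remove_first n l = Some r -> gsum l = nth n env (tg_zero G) ⊕ gsum r.
Proof.
  revert r; induction l as [|m l IH]; simpl; intros r H; [discriminate|].
  destruct (Nat.eqb_spec n m) as [->|_].
  - now injection H as ->.
  - destruct (remove_first n l) as [r'|]; [|discriminate].
    injection H as <-. simpl. rewrite (IH r' eq_refl), !gA, (gC (nth m _ _)). reflexivity.
Qed.

Lemma same_elements_sum l1 l2 : same_elements l1 l2 = true -> gsum l1 = gsum l2.
Proof.
  revert l2; induction l1 as [|n l1 IH]; simpl; intros l2 H.
  - destruct l2; [reflexivity|discriminate].
  - destruct (remove_first n l2) as [r|] eqn:E; [|discriminate].
    rewrite (remove_first_sum _ _ _ E), (IH r H). reflexivity.
Qed.

Lemma gsolve e1 e2 :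
  same_elements (gpos e1 ++ gneg e2) (gpos e2 ++ gneg e1) = true -> geval e1 = geval e2.
Proof.
  intros H; apply same_elements_sum in H. rewrite !gsum_app in H.
  rewrite <- !geval_pos_neg in H.
  apply (g_cancel _ _ (gsum (gneg e1) ⊕ gsum (gneg e2))).
  rewrite !gA. rewrite <- gA in H. rewrite gA in H. rewrite H.
  rewrite <- !gA. f_equal. apply gC.
Qed.
End GroupSolver.

Ltac g_index x env :=
  lazymatch env with
  | x :: _ => constr:(O)
  | _ :: ?l => let n := g_index x l in constr:(S n)
  end.
Ltac g_env t env :=
  lazymatch t with
  | tg_add _ ?a ?b => let env := g_env a env in g_env b env
  | tg_opp _ ?a => g_env a env
  | tg_zero _ => env
  | _ => match env with
         | context [t :: _] => env
         | _ => constr:(t :: env)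
         end
  end.
Ltac g_reify t env :=
  lazymatch t with
  | tg_add _ ?a ?b =>
      let a' := g_reify a env in let b' := g_reify b env in constr:(GA a' b')
  | tg_opp _ ?a => let a' := g_reify a env in constr:(GO a')
  | tg_zero _ => constr:(GZ)
  | _ => let n := g_index t env in constr:(GV n)
  end.
Ltac agroup :=
  match goal with
  | HG : is_compact_abelian_group ?G |- ?a = ?b =>
      let env := g_env a (@nil (tg_car G)) in
      let env := g_env b env in
      let ea := g_reify a env in
      let eb := g_reify b env in
      exact (gsolve G (proj1 HG) env ea eb eq_refl)
  end.

Lemma R_inf (E : R -> Prop) : (exists b, forall s, E s -> b <= s) -> (exists s, E s) ->
  exists t, (forall s, E s -> t <= s) /\ forall eps, 0 < eps -> exists s, E s /\ s < t + eps.
Proof.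
  intros [b Hb] [s0 Hs0].
  destruct (completeness (fun r => E (- r))) as (r & Hr1 & Hr2).
  - exists (- b). intros r Hr. apply Hb in Hr. lra.
  - exists (- s0). now rewrite Ropp_involutive.
  - exists (- r); split.
    + intros s Hs. assert (- s <= r) by (apply Hr1; now rewrite Ropp_involutive). lra.
    + intros eps He. apply NNPP; intros Hn.
      assert (is_upper_bound (fun r => E (- r)) (r - eps)).
      { intros r' Hr'. apply Rnot_lt_le; intros Hlt. apply Hn. exists (- r'). split; [exact Hr'|lra]. }
      apply Hr2 in H. lra.
Qed.

(** * Uniform continuity on a compact abelian group *)

Section CompactGroup.
Variable G : TopAbGroup.
Hypothesis HG : is_compact_abelian_group G.

Notation "'e0'" := (tg_zero G) : ab_scope.

(** Closeness of [x] and [y] is measured by [V (x ⊖ y)], the uniform structure of the group. *)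
Definition nb (V : G -> Prop) : Prop := tg_open G V /\ V e0.

Lemma nb_inter V W : nb V -> nb W -> nb (fun x => V x /\ W x).
Proof.
  pose proof HG as (_ & (_ & _ & Hi & _) & _).
  intros [HV HV0] [HW HW0]; split; auto.
Qed.

Lemma nb_full : nb (fun _ => True).
Proof. split; [apply HG|trivial]. Qed.

Lemma nb_sub V : nb V -> exists W, nb W /\ forall u v, W u -> W v -> V (u ⊖ v).
Proof.
  intros [HV HV0].
  pose proof HG as (_ & _ & Hs & _).
  destruct (Hs e0 e0 V HV) as (A & B & HA & HB & A0 & B0 & H).
  { replace (e0 ⊖ e0) with e0 by agroup. exact HV0. }
  exists (fun x => A x /\ B x); split.
  - apply nb_inter; split; assumption.
  - intros u v [Hu _] [_ Hv]; auto.
Qed.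

Lemma nb_sym V : nb V -> exists W, nb W /\ (forall u, W u -> V u /\ V (⊖ u)).
Proof.
  intros HV. destruct (nb_sub V HV) as (W & HW & H).
  exists (fun x => V x /\ W x); split; [now apply nb_inter|].
  intros u [Hv Hw]; split; [exact Hv|].
  replace (⊖ u) with (e0 ⊖ u) by agroup. apply H; [apply HW|exact Hw].
Qed.

Lemma nb_separates a : a <> e0 -> exists V, nb V /\ ~ V a.
Proof.
  intros Ha. pose proof HG as (_ & _ & _ & Hh & _).
  destruct (Hh a e0 Ha) as (U & V & HU & HV & Ua & V0 & H).
  exists V; split; [now split|]. intros Va; exact (H a Ua Va).
Qed.

(** Compactness for local properties. Indexing the cover by the open sets that satisfy [P] avoids
    choosing a set for each point. *)
Lemma compact_cover (P : (G -> Prop) -> Prop) :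
  (forall x, exists U, tg_open G U /\ U x /\ P U) ->
  exists l : list (G -> Prop), (forall U, In U l -> P U) /\ forall x, exists U, In U l /\ U x.
Proof.
  intros H. pose proof HG as (_ & _ & _ & _ & Hc).
  destruct (Hc {U : G -> Prop | tg_open G U /\ P U} (fun i => proj1_sig i)) as (l & Hl).
  - intros [U HU]; exact (proj1 HU).
  - intros x. destruct (H x) as (U & HU & Ux & HP).
    exists (exist _ U (conj HU HP)); exact Ux.
  - exists (map (@proj1_sig _ _) l); split.
    + intros U HU. apply in_map_iff in HU as ([U' [H1 H2]] & <- & _). exact H2.
    + intros x. destruct (Hl x) as (i & Hi & Hx).
      exists (proj1_sig i); split; [now apply in_map|exact Hx].
Qed.

Lemma nb_finite_inter (T : Type) (R : T -> (G -> Prop) -> Prop)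
  (l : list T) :
  (forall t V W, R t V -> (forall x, W x -> V x) -> R t W) ->
  (forall t, In t l -> exists V, nb V /\ R t V) ->
  exists V, nb V /\ forall t, In t l -> R t V.
Proof.
  intros Hmono. induction l as [|t l IH]; intros H.
  - exists (fun _ => True); split; [apply nb_full|intros ? []].
  - destruct IH as (V & HV & H1); [intros; apply H; now right|].
    destruct (H t (or_introl eq_refl)) as (W & HW & H2).
    exists (fun x => V x /\ W x); split; [now apply nb_inter|].
    intros t' [<-|Ht].
    + apply (Hmono _ _ _ H2); tauto.
    + apply (Hmono _ _ _ (H1 _ Ht)); tauto.
Qed.

Lemma nb_cover V : nb V -> exists L : list G, forall x, exists l, In l L /\ V (x ⊖ l).
Proof.
  intros HV. pose proof HG as (_ & _ & Hs & _).
  destruct (compact_cover (fun U => exists l, forall u, U u -> V (u ⊖ l))) as (l & H1 & H2).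
  - intros x. destruct (Hs x x V (proj1 HV)) as (A & B & HA & HB & Ax & Bx & H).
    { replace (x ⊖ x) with e0 by agroup. apply HV. }
    exists A; repeat split; auto. exists x; auto.
  - assert (HL : exists L, forall U, In U l -> exists z, In z L /\ forall u, U u -> V (u ⊖ z)).
    { clear H2. induction l as [|U l IH].
      - exists []; intros U [].
      - destruct IH as (L & HL); [intros; apply H1; now right|].
        destruct (H1 U (or_introl eq_refl)) as (z & Hz).
        exists (z :: L). intros U' [<-|H].
        + exists z; split; [now left|exact Hz].
        + destruct (HL U' H) as (z' & ? & ?); exists z'; split; [now right|assumption]. }
    destruct HL as (L & HL). exists L. intros x.
    destruct (H2 x) as (U & HU & Ux). destruct (HL U HU) as (z & Hz & H).
    exists z; auto.
Qed.

(** Continuity is taken in uniform form because averaging over translates preserves the pair [V],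
    [eps] exactly. *)
Definition rcont (f : G -> R) : Prop :=
  forall eps, 0 < eps -> exists V, nb V /\ forall x y, V (x ⊖ y) -> Rabs (f x - f y) <= eps.

(** Lebesgue number argument: around [x] there are [A] and [B] with [A - B] inside a set where [f]
    stays within [eps / 2] of [f x]. Finitely many [A] cover the group, and the intersection of
    their [B] is the uniform neighbourhood. *)
Lemma rcont_of_pointwise (f : G -> R) :
  (forall x eps, 0 < eps ->
     exists U, tg_open G U /\ U x /\ forall y, U y -> Rabs (f y - f x) < eps) ->
  rcont f.
Proof.
  intros Hf eps Heps. pose proof HG as (_ & _ & Hs & _).
  set (Q := fun (A V : G -> Prop) => forall x y, A x -> V (x ⊖ y) -> Rabs (f x - f y) <= eps).
  destruct (compact_cover (fun A => exists B, nb B /\ Q A B)) as (l & H1 & H2).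
  - intros x. destruct (Hf x (eps / 2)) as (U & HU & Ux & H); [lra|].
    destruct (Hs x e0 U HU) as (A & B & HA & HB & Ax & B0 & HAB).
    { replace (x ⊖ e0) with x by agroup. exact Ux. }
    exists A; repeat split; auto. exists B; split; [now split|].
    intros u v Hu Hv.
    assert (Uu : U u) by (replace u with (u ⊖ e0) by agroup; auto).
    assert (Uv : U v) by (replace v with (u ⊖ (u ⊖ v)) by agroup; auto).
    apply H in Uu, Uv. apply Rabs_def2 in Uu, Uv. apply Rabs_le; lra.
  - destruct (nb_finite_inter _ Q l) as (V & HV & H).
    + intros A V W H HW x y Ax Wx; auto.
    + exact H1.
    + exists V; split; [exact HV|]. intros x y Hxy.
      destruct (H2 x) as (U & HU & Ux). exact (H U HU x y Ux Hxy).
Qed.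

Lemma rcont_pointwise (f : G -> R) : rcont f ->
  forall x eps, 0 < eps ->
  exists U, tg_open G U /\ U x /\ forall y, U y -> Rabs (f y - f x) < eps.
Proof.
  intros Hf x eps Heps. destruct (Hf (eps / 2)) as (V & HV & H); [lra|].
  pose proof HG as (_ & _ & Hs & _).
  destruct (Hs x x V (proj1 HV)) as (A & B & HA & HB & Ax & Bx & HAB).
  { replace (x ⊖ x) with e0 by agroup. apply HV. }
  exists A; repeat split; auto. intros y Ay.
  apply Rle_lt_trans with (eps / 2); [apply H; auto|lra].
Qed.

Lemma rcont_bounded f : rcont f -> exists B, 0 <= B /\ forall x, Rabs (f x) <= B.
Proof.
  intros Hf. destruct (Hf 1) as (V & HV & H); [lra|].
  destruct (nb_cover V HV) as (L & HL).
  assert (HB : exists B, 0 <= B /\ forall l, In l L -> Rabs (f l) <= B).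
  { clear HL. induction L as [|l L (B & HB & IH)].
    - exists 0; split; [lra|intros ? []].
    - exists (B + Rabs (f l)); split; [pose proof (Rabs_pos (f l)); lra|].
      intros l' [<-|Hl]; [lra|]. specialize (IH l' Hl). pose proof (Rabs_pos (f l)); lra. }
  destruct HB as (B & HB0 & HB). exists (B + 1); split; [lra|].
  intros x. destruct (HL x) as (l & Hl & Hx). apply H in Hx. apply HB in Hl.
  replace (f x) with (f l + (f x - f l)) by ring.
  eapply Rle_trans; [apply Rabs_triang|lra].
Qed.

(** Joint uniform continuity, needed for means with a parameter and for Fubini. Sums and products
    are treated here; their one-variable versions are read off by ignoring a variable. *)
Definition jcont (F : G -> G -> R) : Prop :=
  forall eps, 0 < eps -> exists V, nb V /\ forall x x' y y',
    V (x ⊖ x') -> V (y ⊖ y') -> Rabs (F x y - F x' y') <= eps.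

Lemma jcont_row F x : jcont F -> rcont (F x).
Proof.
  intros HF eps He. destruct (HF eps He) as (V & HV & H).
  exists V; split; [exact HV|]. intros y y' Hy. apply H; [|exact Hy].
  replace (x ⊖ x) with e0 by agroup. apply HV.
Qed.

Lemma jcont_flip F : jcont F -> jcont (fun x y => F y x).
Proof.
  intros HF eps He. destruct (HF eps He) as (V & HV & H).
  exists V; split; [exact HV|]. auto.
Qed.

Lemma jcont_col F y : jcont F -> rcont (fun x => F x y).
Proof. intros HF. apply (jcont_row _ y (jcont_flip _ HF)). Qed.

Lemma jcont_bounded F : jcont F -> exists B, 0 <= B /\ forall x y, Rabs (F x y) <= B.
Proof.
  intros HF. destruct (HF 1) as (V & HV & H); [lra|].
  destruct (nb_cover V HV) as (L & HL).
  assert (HB : exists B, 0 <= B /\ forall l y, In l L -> Rabs (F l y) <= B).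
  { clear HL. induction L as [|l L (B & HB & IH)].
    - exists 0; split; [lra|intros ? ? []].
    - destruct (rcont_bounded _ (jcont_row F l HF)) as (B' & HB' & H').
      exists (B + B'); split; [lra|].
      intros l' y [<-|Hl]; [specialize (H' y)|specialize (IH l' y Hl)]; lra. }
  destruct HB as (B & HB0 & HB). exists (B + 1); split; [lra|].
  intros x y. destruct (HL x) as (l & Hl & Hx). apply (HB _ y) in Hl.
  assert (Rabs (F x y - F l y) <= 1).
  { apply H; [exact Hx|]. replace (y ⊖ y) with e0 by agroup. apply HV. }
  replace (F x y) with (F l y + (F x y - F l y)) by ring.
  eapply Rle_trans; [apply Rabs_triang|lra].
Qed.

Lemma jcont_snd f : rcont f -> jcont (fun _ y => f y).
Proof.
  intros Hf eps He. destruct (Hf eps He) as (V & HV & H).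
  exists V; split; auto.
Qed.

Lemma jcont_fst f : rcont f -> jcont (fun x _ => f x).
Proof. intros Hf. apply jcont_flip, jcont_snd, Hf. Qed.

Lemma jcont_sub f : rcont f -> jcont (fun x y => f (x ⊖ y)).
Proof.
  intros Hf eps He. destruct (Hf eps He) as (V & HV & H).
  destruct (nb_sub V HV) as (W & HW & HWV).
  exists W; split; [exact HW|]. intros x x' y y' Hx Hy. apply H.
  replace (x ⊖ y ⊖ (x' ⊖ y')) with ((x ⊖ x') ⊖ (y ⊖ y')) by agroup. auto.
Qed.

Lemma jcont_add F F' : jcont F -> jcont F' -> jcont (fun x y => F x y + F' x y).
Proof.
  intros HF HF' eps He.
  destruct (HF (eps / 2)) as (V & HV & H); [lra|].
  destruct (HF' (eps / 2)) as (V' & HV' & H'); [lra|].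
  exists (fun x => V x /\ V' x); split; [now apply nb_inter|].
  intros x x' y y' [Hx Hx'] [Hy Hy'].
  specialize (H _ _ _ _ Hx Hy). specialize (H' _ _ _ _ Hx' Hy').
  replace (_ - _) with ((F x y - F x' y') + (F' x y - F' x' y')) by ring.
  eapply Rle_trans; [apply Rabs_triang|lra].
Qed.

Lemma jcont_mul F F' : jcont F -> jcont F' -> jcont (fun x y => F x y * F' x y).
Proof.
  intros HF HF' eps He.
  destruct (jcont_bounded F HF) as (B & HB0 & HB).
  destruct (jcont_bounded F' HF') as (B' & HB0' & HB').
  set (d := eps / (B + B' + 1)).
  assert (Hd : 0 < d) by (apply Rdiv_lt_0_compat; lra).
  assert (Hdm : d * (B + B' + 1) = eps) by (unfold d; field; lra).
  destruct (HF d Hd) as (V & HV & H).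
  destruct (HF' d Hd) as (V' & HV' & H').
  exists (fun x => V x /\ V' x); split; [now apply nb_inter|].
  intros x x' y y' [Hx Hx'] [Hy Hy'].
  specialize (H _ _ _ _ Hx Hy). specialize (H' _ _ _ _ Hx' Hy').
  replace (_ - _) with ((F x y - F x' y') * F' x y + F x' y' * (F' x y - F' x' y')) by ring.
  eapply Rle_trans; [apply Rabs_triang|]. rewrite !Rabs_mult.
  specialize (HB x' y'). specialize (HB' x y).
  assert (Rabs (F x y - F x' y') * Rabs (F' x y) <= d * B')
    by (apply Rmult_le_compat; auto using Rabs_pos).
  assert (Rabs (F x' y') * Rabs (F' x y - F' x' y') <= B * d)
    by (apply Rmult_le_compat; auto using Rabs_pos).
  nra.
Qed.

Lemma rcont_const c : rcont (fun _ => c).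
Proof.
  intros eps He. exists (fun _ => True); split; [apply nb_full|].
  intros. rewrite Rminus_diag, Rabs_R0. lra.
Qed.

Lemma rcont_add f g : rcont f -> rcont g -> rcont (fun x => f x + g x).
Proof.
  intros Hf Hg. exact (jcont_col _ e0 (jcont_add _ _ (jcont_fst f Hf) (jcont_fst g Hg))).
Qed.

Lemma rcont_mul f g : rcont f -> rcont g -> rcont (fun x => f x * g x).
Proof.
  intros Hf Hg. exact (jcont_col _ e0 (jcont_mul _ _ (jcont_fst f Hf) (jcont_fst g Hg))).
Qed.

Lemma rcont_scal c f : rcont f -> rcont (fun x => c * f x).
Proof. intros Hf. apply (rcont_mul (fun _ => c)); [apply rcont_const|exact Hf]. Qed.

Lemma rcont_opp f : rcont f -> rcont (fun x => - f x).
Proof.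
  intros Hf. replace (fun x => - f x) with (fun x => (-1) * f x)
    by (apply functional_extensionality; intros; ring). now apply rcont_scal.
Qed.

Lemma rcont_sub f g : rcont f -> rcont g -> rcont (fun x => f x - g x).
Proof. intros Hf Hg. apply (rcont_add f _ Hf (rcont_opp g Hg)). Qed.

Lemma rcont_refl f c : rcont f -> rcont (fun x => f (c ⊖ x)).
Proof. intros Hf. exact (jcont_row _ c (jcont_sub f Hf)). Qed.

Lemma rcont_neg f : rcont f -> rcont (fun x => f (⊖ x)).
Proof.
  intros Hf. replace (fun x => f (⊖ x)) with (fun x => f (e0 ⊖ x)).
  - now apply rcont_refl.
  - apply functional_extensionality; intros x; f_equal; agroup.
Qed.

Lemma rcont_tr f c : rcont f -> rcont (fun x => f (x ⊕ c)).
Proof.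
  intros Hf. replace (fun x => f (x ⊕ c)) with (fun x => f (x ⊖ (⊖ c))).
  - exact (jcont_col _ (⊖ c) (jcont_sub f Hf)).
  - apply functional_extensionality; intros x; f_equal; agroup.
Qed.

Lemma jcont_opp F : jcont F -> jcont (fun x y => - F x y).
Proof.
  intros HF. replace (fun x y => - F x y) with (fun x y => (-1) * F x y).
  - apply (jcont_mul (fun _ _ => -1)); [apply jcont_fst, rcont_const|exact HF].
  - do 2 (apply functional_extensionality; intros); ring.
Qed.

(** * The invariant mean *)

(** Convex combinations of translates with dyadic weights, kept as operators: composition is then
    available without formulas for the weights, and each property is an induction on three cases. *)
Inductive Avg : ((G -> R) -> G -> R) -> Prop :=
| Avg_tr l : Avg (fun f x => f (x ⊕ l))
| Avg_mid A B : Avg A -> Avg B -> Avg (fun f x => (A f x + B f x) / 2)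
| Avg_comp A B : Avg A -> Avg B -> Avg (fun f => A (B f)).

Lemma Avg_add A f g x : Avg A -> A (fun y => f y + g y) x = A f x + A g x.
Proof.
  intros HA; revert f g x; induction HA as [l|A B _ IHA _ IHB|A B _ IHA _ IHB]; intros f g x.
  - reflexivity.
  - rewrite IHA, IHB; field.
  - rewrite <- IHA. f_equal. apply functional_extensionality; intros; apply IHB.
Qed.

Lemma Avg_scal A c f x : Avg A -> A (fun y => c * f y) x = c * A f x.
Proof.
  intros HA; revert f x; induction HA as [l|A B _ IHA _ IHB|A B _ IHA _ IHB]; intros f x.
  - reflexivity.
  - rewrite IHA, IHB; field.
  - rewrite <- IHA. f_equal. apply functional_extensionality; intros; apply IHB.
Qed.

Lemma Avg_le A f g : Avg A -> (forall x, f x <= g x) -> forall x, A f x <= A g x.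
Proof.
  intros HA; revert f g; induction HA as [l|A B _ IHA _ IHB|A B _ IHA _ IHB]; intros f g H x; auto.
  specialize (IHA f g H x); specialize (IHB f g H x); lra.
Qed.

Lemma Avg_const A c x : Avg A -> A (fun _ => c) x = c.
Proof.
  intros HA; revert x; induction HA as [l|A B _ IHA _ IHB|A B _ IHA _ IHB]; intros x.
  - reflexivity.
  - rewrite IHA, IHB; field.
  - transitivity (A (fun _ => c) x); [|apply IHA].
    f_equal. apply functional_extensionality; apply IHB.
Qed.

Lemma Avg_close A f c eps : Avg A -> (forall x, Rabs (f x - c) <= eps) ->
  forall x, Rabs (A f x - c) <= eps.
Proof.
  intros HA H x. apply Rabs_le. split.
  - apply Rplus_le_reg_r with c.
    rewrite <- (Avg_const A (- eps + c) x HA) .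
    replace (A f x - c + c) with (A f x) by ring.
    apply Avg_le; [exact HA|]. intros y. destruct (Rabs_le_between (f y - c) eps) as [H1 _].
    specialize (H1 (H y)). lra.
  - apply Rplus_le_reg_r with c.
    rewrite <- (Avg_const A (eps + c) x HA) .
    replace (A f x - c + c) with (A f x) by ring.
    apply Avg_le; [exact HA|]. intros y. destruct (Rabs_le_between (f y - c) eps) as [H1 _].
    specialize (H1 (H y)). lra.
Qed.

Lemma Avg_translate A f l x : Avg A -> A (fun y => f (y ⊕ l)) x = A f (x ⊕ l).
Proof.
  intros HA; revert f x; induction HA as [k|A B _ IHA _ IHB|A B _ IHA _ IHB]; intros f x.
  - f_equal; agroup.
  - rewrite IHA, IHB; reflexivity.
  - rewrite <- IHA. f_equal. apply functional_extensionality; intros; apply IHB.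
Qed.

(** Translations commute because [G] is abelian. This is the source of both uniqueness and
    additivity of the mean. *)
Lemma Avg_commute A B f x : Avg A -> Avg B -> A (B f) x = B (A f) x.
Proof.
  intros HA HB; revert f x; induction HB as [l|B B' _ IHB _ IHB'|B B' _ IHB _ IHB']; intros f x.
  - now apply Avg_translate.
  - replace (fun x0 => (B f x0 + B' f x0) / 2) with (fun x0 => / 2 * (B f x0 + B' f x0))
      by (apply functional_extensionality; intros; field).
    rewrite Avg_scal, Avg_add, IHB, IHB' by exact HA. field.
  - rewrite IHB. f_equal. apply functional_extensionality; intros; apply IHB'.
Qed.

(** The neighbourhood [V] is the same for all averages [A]; the existence of the mean depends on
    this uniformity. *)
Lemma Avg_modulus A f V eps : Avg A ->
  (forall x y, V (x ⊖ y) -> Rabs (f x - f y) <= eps) ->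
  forall x y, V (x ⊖ y) -> Rabs (A f x - A f y) <= eps.
Proof.
  intros HA; revert f; induction HA as [l|A B _ IHA _ IHB|A B _ IHA _ IHB]; intros f H x y Hxy.
  - apply H. replace (x ⊕ l ⊖ (y ⊕ l)) with (x ⊖ y) by agroup. exact Hxy.
  - specialize (IHA f H x y Hxy). specialize (IHB f H x y Hxy).
    apply Rabs_le_between in IHA, IHB. apply Rabs_le. lra.
  - apply IHA; auto.
Qed.

Lemma Avg_rcont A f : Avg A -> rcont f -> rcont (A f).
Proof.
  intros HA Hf eps He. destruct (Hf eps He) as (V & HV & H).
  exists V; split; [exact HV|]. now apply Avg_modulus.
Qed.

(* The average gives weight at least [d] to every translation in [L]. *)
Lemma Avg_of_list (L : list G) :
  exists A d, Avg A /\ 0 < d <= 1 /\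
    forall g s m x, (forall y, g y <= s) -> m <= s -> (exists l, In l L /\ g (x ⊕ l) <= m) ->
    A g x <= s - d * (s - m).
Proof.
  induction L as [|l L (A & d & HA & Hd & IH)].
  - exists (fun f x => f (x ⊕ e0)), 1. split; [constructor|split; [lra|]].
    intros g s m x _ _ (l & [] & _).
  - exists (fun f x => (f (x ⊕ l) + A f x) / 2), (d / 2).
    split; [apply (Avg_mid (fun f x => f (x ⊕ l)) A); [constructor|exact HA]|].
    split; [lra|]. intros g s m x Hs Hms (l' & [<-|Hl] & Hm).
    + assert (A g x <= s).
      { rewrite <- (Avg_const A s x HA). now apply Avg_le. }
      nra.
    + specialize (IH g s m x Hs Hms (ex_intro _ l' (conj Hl Hm))).
      specialize (Hs (x ⊕ l)). lra.
Qed.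

Definition IsMean (f : G -> R) (c : R) : Prop :=
  forall eps, 0 < eps -> exists A, Avg A /\ forall x, Rabs (A f x - c) <= eps.

Lemma IsMean_unique f c d : IsMean f c -> IsMean f d -> c = d.
Proof.
  intros Hc Hd. apply cond_eq. intros eps He.
  destruct (Hc (eps / 3)) as (A & HA & H1); [lra|].
  destruct (Hd (eps / 3)) as (B & HB & H2); [lra|].
  apply (Avg_close B _ _ _ HB) with (x := e0) in H1.
  apply (Avg_close A _ _ _ HA) with (x := e0) in H2.
  rewrite (Avg_commute A B f e0 HA HB) in H2.
  apply Rabs_le_between in H1, H2. apply Rabs_def1; lra.
Qed.

(* If [s] is the infimum of the suprema of averages of [f], then an average with supremum close
   to [s] cannot dip far below [s]: by uniform continuity the dip has a size that is independent of
   the average, so averaging once more would bring the supremum below [s]. *)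
Lemma IsMean_exists f : rcont f -> exists c, IsMean f c.
Proof.
  intros Hf. destruct (rcont_bounded f Hf) as (B & HB0 & HB).
  set (E := fun t => exists A, Avg A /\ forall x, A f x <= t).
  destruct (R_inf E) as (t & Ht1 & Ht2).
  - exists (- B). intros t (A & HA & H). apply Rle_trans with (A f e0); [|apply H].
    rewrite <- (Avg_const A (- B) e0 HA). apply Avg_le; [exact HA|].
    intros x; specialize (HB x). apply Rabs_le_between in HB; lra.
  - exists B, (fun f x => f (x ⊕ e0)). split; [constructor|].
    intros x; specialize (HB (x ⊕ e0)). apply Rabs_le_between in HB; lra.
  - exists t. intros eps He.
    destruct (Hf (eps / 2)) as (V & HV & H); [lra|].
    destruct (nb_cover V HV) as (L & HL).
    destruct (Avg_of_list L) as (D & d & HD & Hd & HDL).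
    assert (Hde : 0 < d * (eps / 2)) by nra.
    destruct (Ht2 _ Hde) as (t' & (A & HA & Ht') & Htt).
    exists A; split; [exact HA|].
    assert (Hup : forall x, A f x <= t + d * (eps / 2)) by (intros x; specialize (Ht' x); lra).
    intros x0.
    pose proof (Avg_modulus A f V (eps / 2) HA H) as Hmod.
    assert (Hlow : t - eps <= A f x0).
    { apply Rnot_lt_le. intros Hlt.
      set (m := A f x0 + eps / 2).
      assert (HE : E (t + d * (eps / 2) - d * (t + d * (eps / 2) - m))).
      { exists (fun f => D (A f)); split; [now constructor|]. intros x.
        apply HDL; [exact Hup|unfold m; nra|].
        destruct (HL (x0 ⊖ x)) as (l & Hl & Hx). exists l; split; [exact Hl|].
        assert (Hv : V (x0 ⊖ (x ⊕ l))).
        { replace (x0 ⊖ (x ⊕ l)) with (x0 ⊖ x ⊖ l) by agroup. exact Hx. }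
        apply Hmod in Hv. apply Rabs_le_between in Hv. unfold m. lra. }
      apply Ht1 in HE. unfold m in HE. nra. }
    apply Rabs_le. specialize (Hup x0). split; nra.
Qed.

(** Total by choice: the value is arbitrary when no mean exists, hence the continuity hypotheses in
    the laws below. *)
Definition M (f : G -> R) : R := epsilon (inhabits 0) (IsMean f).

Lemma M_spec f : rcont f -> IsMean f (M f).
Proof. intros Hf. exact (epsilon_spec _ _ (IsMean_exists f Hf)). Qed.

Lemma M_eq f c : IsMean f c -> M f = c.
Proof.
  intros H. apply (IsMean_unique f); [|exact H].
  exact (epsilon_spec _ _ (ex_intro _ c H)).
Qed.

(** One average serves both functions: an average that is good for [f] stays good after composition
    with any other ([Avg_close]). *)
Lemma M_add f g : rcont f -> rcont g -> M (fun x => f x + g x) = M f + M g.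
Proof.
  intros Hf Hg. apply M_eq. intros eps He.
  destruct (M_spec f Hf (eps / 2)) as (A & HA & H1); [lra|].
  destruct (M_spec g Hg (eps / 2)) as (B & HB & H2); [lra|].
  exists (fun f => A (B f)); split; [now constructor|]. intros x.
  replace (A (B (fun x0 => f x0 + g x0)) x) with (B (A f) x + A (B g) x).
  - apply (Avg_close B _ _ _ HB) with (x := x) in H1.
    apply (Avg_close A _ _ _ HA) with (x := x) in H2.
    apply Rabs_le_between in H1, H2. apply Rabs_le; lra.
  - rewrite <- (Avg_commute A B f x HA HB), <- Avg_add by exact HA. f_equal.
    apply functional_extensionality; intros y. now rewrite Avg_add.
Qed.

Lemma M_scal c f : rcont f -> M (fun x => c * f x) = c * M f.
Proof.
  intros Hf. apply M_eq. intros eps He.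
  destruct (M_spec f Hf (eps / (Rabs c + 1))) as (A & HA & H1).
  { apply Rdiv_lt_0_compat; [lra|]. pose proof (Rabs_pos c); lra. }
  exists A; split; [exact HA|]. intros x. rewrite (Avg_scal A c f x HA).
  replace (_ - _) with (c * (A f x - M f)) by ring. rewrite Rabs_mult.
  pose proof (Rabs_pos c).
  apply Rle_trans with (Rabs c * (eps / (Rabs c + 1))).
  - apply Rmult_le_compat_l; auto.
  - replace eps with ((Rabs c + 1) * (eps / (Rabs c + 1))) at 2 by (field; lra).
    apply Rmult_le_compat_r; [|lra]. apply Rlt_le, Rdiv_lt_0_compat; lra.
Qed.

Lemma M_const c : M (fun _ => c) = c.
Proof.
  apply M_eq. intros eps He. exists (fun f x => f (x ⊕ e0)); split; [constructor|].
  intros _. rewrite Rminus_diag, Rabs_R0. lra.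
Qed.

Lemma M_opp f : rcont f -> M (fun x => - f x) = - M f.
Proof.
  intros Hf. replace (- M f) with ((-1) * M f) by ring. rewrite <- M_scal by exact Hf.
  f_equal. apply functional_extensionality; intros; ring.
Qed.

Lemma M_sub f g : rcont f -> rcont g -> M (fun x => f x - g x) = M f - M g.
Proof.
  intros Hf Hg. unfold Rminus. rewrite M_add, M_opp; auto using rcont_opp.
Qed.

Lemma M_ge0 f : rcont f -> (forall x, 0 <= f x) -> 0 <= M f.
Proof.
  intros Hf H. apply Rnot_lt_le. intros Hlt.
  destruct (M_spec f Hf (- M f / 2)) as (A & HA & H1); [lra|].
  specialize (H1 e0). apply Rabs_le_between in H1.
  assert (0 <= A f e0); [|lra].
  rewrite <- (Avg_const A 0 e0 HA). now apply Avg_le.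
Qed.

Lemma M_le f g : rcont f -> rcont g -> (forall x, f x <= g x) -> M f <= M g.
Proof.
  intros Hf Hg H. assert (0 <= M (fun x => g x - f x)).
  { apply M_ge0; [now apply rcont_sub|]. intros x; specialize (H x); lra. }
  rewrite M_sub in H0; auto. lra.
Qed.

Lemma M_abs_le f B : rcont f -> (forall x, Rabs (f x) <= B) -> Rabs (M f) <= B.
Proof.
  intros Hf H. apply Rabs_le. split.
  - rewrite <- (M_const (- B)). apply M_le; auto using rcont_const.
    intros x; specialize (H x); apply Rabs_le_between in H; lra.
  - rewrite <- (M_const B). apply M_le; auto using rcont_const.
    intros x; specialize (H x); apply Rabs_le_between in H; lra.
Qed.

Lemma M_Avg A f : Avg A -> rcont f -> M (A f) = M f.
Proof.
  intros HA Hf. apply M_eq. intros eps He.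
  destruct (M_spec f Hf eps He) as (B & HB & H).
  exists B; split; [exact HB|]. intros x.
  rewrite (Avg_commute B A f x HB HA). now apply Avg_close.
Qed.

Lemma M_tr f l : rcont f -> M (fun x => f (x ⊕ l)) = M f.
Proof. intros Hf. apply (M_Avg (fun f x => f (x ⊕ l)) f); [constructor|exact Hf]. Qed.

Lemma Avg_neg A : Avg A -> exists A', Avg A' /\
  forall f x, A' (fun y => f (⊖ y)) x = A f (⊖ x).
Proof.
  intros HA; induction HA as [l|A B _ (A' & HA & IHA) _ (B' & HB & IHB)
                             |A B _ (A' & HA & IHA) _ (B' & HB & IHB)].
  - exists (fun f x => f (x ⊕ (⊖ l))); split; [constructor|]. intros f x. f_equal; agroup.
  - exists (fun f x => (A' f x + B' f x) / 2); split; [now constructor|].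
    intros f x. now rewrite IHA, IHB.
  - exists (fun f => A' (B' f)); split; [now constructor|].
    intros f x. rewrite <- IHA. f_equal. apply functional_extensionality; auto.
Qed.

Lemma M_neg f : rcont f -> M (fun x => f (⊖ x)) = M f.
Proof.
  intros Hf. apply M_eq. intros eps He.
  destruct (M_spec f Hf eps He) as (A & HA & H).
  destruct (Avg_neg A HA) as (A' & HA' & HAA).
  exists A'; split; [exact HA'|]. intros x. rewrite HAA. apply H.
Qed.

(** Near [x0] the function exceeds [f x0 / 2]. Finitely many translates of that neighbourhood cover
    [G], so a single average [D f] is bounded below by a positive constant everywhere. *)
Lemma M_gt0 f x0 : rcont f -> (forall x, 0 <= f x) -> 0 < f x0 -> 0 < M f.
Proof.
  intros Hf H0 Hx0. destruct (Hf (f x0 / 2)) as (V & HV & H); [lra|].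
  destruct (nb_cover V HV) as (L & HL).
  destruct (Avg_of_list L) as (D & d & HD & Hd & HDL).
  rewrite <- (M_Avg D f HD Hf).
  apply Rlt_le_trans with (d * (f x0 / 2)); [nra|].
  rewrite <- (M_const (d * (f x0 / 2))).
  apply M_le; [apply rcont_const|now apply Avg_rcont|].
  (* [Avg_of_list] bounds averages from above, so it is applied to [-f], with supremum bound [0] and
     dip [-(f x0 / 2)]. *)
  intros x. specialize (HDL (fun y => (-1) * f y) 0 (- (f x0 / 2)) x).
  rewrite Avg_scal in HDL by exact HD.
  assert (-1 * D f x <= 0 - d * (0 - - (f x0 / 2))); [|lra].
  apply HDL; [intros y; specialize (H0 y); lra|lra|].
  destruct (HL (x0 ⊖ x)) as (l & Hl & Hx). exists l; split; [exact Hl|].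
  assert (Hv : V (x0 ⊖ (x ⊕ l))).
  { replace (x0 ⊖ (x ⊕ l)) with (x0 ⊖ x ⊖ l) by agroup. exact Hx. }
  apply H in Hv. apply Rabs_le_between in Hv. lra.
Qed.

Lemma rcont_M F : jcont F -> rcont (fun x => M (F x)).
Proof.
  intros HF eps He. destruct (HF eps He) as (V & HV & H).
  exists V; split; [exact HV|]. intros x y Hxy.
  rewrite <- M_sub by (apply jcont_row, HF).
  apply M_abs_le; [apply rcont_sub; apply jcont_row, HF|].
  intros z. apply H; [exact Hxy|]. replace (z ⊖ z) with e0 by agroup. apply HV.
Qed.

Lemma Avg_jcont A F : Avg A -> jcont F -> jcont (fun x => A (F x)).
Proof.
  intros HA; revert F; induction HA as [l|A B _ IHA _ IHB|A B _ IHA _ IHB]; intros F HF.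
  - intros eps He. destruct (HF eps He) as (V & HV & H).
    exists V; split; [exact HV|]. intros x x' y y' Hx Hy. apply H; [exact Hx|].
    replace (y ⊕ l ⊖ (y' ⊕ l)) with (y ⊖ y') by agroup. exact Hy.
  - replace (fun x x0 => (A (F x) x0 + B (F x) x0) / 2)
      with (fun x x0 => / 2 * (A (F x) x0 + B (F x) x0)).
    + apply (jcont_mul (fun _ _ => / 2)); [apply jcont_fst, rcont_const|].
      apply jcont_add; [apply (IHA F HF)|apply (IHB F HF)].
    + do 2 (apply functional_extensionality; intros); field.
  - apply (IHA (fun x => B (F x))). auto.
Qed.

Lemma Avg_M_exchange A F z : Avg A -> jcont F ->
  A (fun z => M (fun y => F y z)) z = M (fun y => A (F y) z).
Proof.
  intros HA; revert F z; induction HA as [l|A B HA IHA HB IHB|A B HA IHA HB IHB]; intros F z HF.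
  - reflexivity.
  - rewrite IHA, IHB by exact HF.
    replace (fun y => (A (F y) z + B (F y) z) / 2)
      with (fun y => / 2 * (A (F y) z + B (F y) z))
      by (apply functional_extensionality; intros; field).
    assert (Ha : rcont (fun y => A (F y) z)) by (apply (jcont_col (fun y => A (F y))), Avg_jcont; auto).
    assert (Hb : rcont (fun y => B (F y) z)) by (apply (jcont_col (fun y => B (F y))), Avg_jcont; auto).
    rewrite M_scal, M_add; auto using rcont_add. field.
  - rewrite <- (IHA (fun y => B (F y)) z).
    + f_equal. apply functional_extensionality; auto.
    + now apply Avg_jcont.
Qed.

(** An average that is good for the finitely many rows [F l] with [l] in a net is good for all rows,
    at the cost of [eps / 3] for the row and [eps / 3] for its mean. With an average independent of
    [y], Fubini reduces to exchanging [M] with finite sums. *)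
Lemma M_uniform F eps : jcont F -> 0 < eps ->
  exists A, Avg A /\ forall y z, Rabs (A (F y) z - M (F y)) <= eps.
Proof.
  intros HF He. destruct (HF (eps / 3)) as (V & HV & H); [lra|].
  destruct (nb_cover V HV) as (L & HL).
  assert (HA : exists A, Avg A /\ forall y, In y L -> forall z, Rabs (A (F y) z - M (F y)) <= eps / 3).
  { clear HL. induction L as [|l L (A & HA & IH)].
    - exists (fun f x => f (x ⊕ e0)); split; [constructor|intros ? []].
    - destruct (M_spec (F l) (jcont_row F l HF) (eps / 3)) as (B & HB & H1); [lra|].
      exists (fun f => A (B f)); split; [now constructor|].
      intros y [<-|Hy] z.
      + now apply Avg_close.
      + rewrite (Avg_commute A B _ _ HA HB). apply Avg_close; auto. }
  destruct HA as (A & HA & HAL). exists A; split; [exact HA|].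
  intros y z. destruct (HL y) as (l & Hl & Hy).
  assert (Hc : forall w, Rabs (F y w - F l w) <= eps / 3).
  { intros w. apply H; [exact Hy|]. replace (w ⊖ w) with e0 by agroup. apply HV. }
  assert (H1 : Rabs (M (F y) - M (F l)) <= eps / 3).
  { rewrite <- M_sub by (apply jcont_row, HF).
    apply M_abs_le; [apply rcont_sub; apply jcont_row, HF|exact Hc]. }
  assert (H2 : Rabs (A (F y) z - A (F l) z) <= eps / 3).
  { replace (A (F y) z - A (F l) z) with (A (fun w => F y w + (-1) * F l w) z - 0)
      by (rewrite Avg_add, Avg_scal by exact HA; ring).
    apply Avg_close; [exact HA|]. intros w.
    replace (F y w + -1 * F l w - 0) with (F y w - F l w) by ring. apply Hc. }
  specialize (HAL l Hl z). apply Rabs_le_between in H1, H2, HAL. apply Rabs_le; lra.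
Qed.

Lemma M_fubini F : jcont F -> M (fun y => M (F y)) = M (fun z => M (fun y => F y z)).
Proof.
  intros HF. symmetry. apply M_eq. intros eps He.
  destruct (M_uniform F eps HF He) as (A & HA & H).
  exists A; split; [exact HA|]. intros z.
  rewrite Avg_M_exchange by auto.
  assert (Ha : rcont (fun y => A (F y) z)) by (apply (jcont_col (fun y => A (F y))), Avg_jcont; auto).
  rewrite <- M_sub by auto using rcont_M.
  apply M_abs_le; [apply rcont_sub; auto using rcont_M|]. intros y; apply H.
Qed.

(** * The convolution algebra of continuous functions *)

Definition ccont (f : G -> C) : Prop :=
  rcont (fun x => Re (f x)) /\ rcont (fun x => Im (f x)).
Definition cjcont (F : G -> G -> C) : Prop :=
  jcont (fun x y => Re (F x y)) /\ jcont (fun x y => Im (F x y)).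
Definition Mc (f : G -> C) : C := (M (fun x => Re (f x)), M (fun x => Im (f x))).

Lemma C_ext (z w : C) : Re z = Re w -> Im z = Im w -> z = w.
Proof. destruct z, w; simpl; intros -> ->; reflexivity. Qed.

Lemma ccont_add f g : ccont f -> ccont g -> ccont (fun x => f x + g x)%C.
Proof. intros [] []; split; simpl; now apply rcont_add. Qed.

Lemma ccont_mul f g : ccont f -> ccont g -> ccont (fun x => f x * g x)%C.
Proof.
  intros [] []; split; simpl; [apply rcont_sub|apply rcont_add]; now apply rcont_mul.
Qed.

Lemma ccont_const c : ccont (fun _ => c).
Proof. split; apply rcont_const. Qed.

Lemma ccont_scal c f : ccont f -> ccont (fun x => c * f x)%C.
Proof. apply (ccont_mul (fun _ => c)), ccont_const. Qed.

Lemma ccont_conj f : ccont f -> ccont (fun x => Cconj (f x)).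
Proof. intros []; split; simpl; [assumption|now apply rcont_opp]. Qed.

Lemma ccont_neg f : ccont f -> ccont (fun x => f (⊖ x)).
Proof.
  intros []; split; [apply (rcont_neg (fun x => Re (f x)))|apply (rcont_neg (fun x => Im (f x)))];
    assumption.
Qed.

Lemma ccont_tr f a : ccont f -> ccont (fun x => f (x ⊕ a)).
Proof.
  intros []; split; [apply (rcont_tr (fun x => Re (f x)))|apply (rcont_tr (fun x => Im (f x)))];
    assumption.
Qed.

Lemma ccont_refl f a : ccont f -> ccont (fun x => f (a ⊖ x)).
Proof.
  intros []; split; [apply (rcont_refl (fun x => Re (f x)))|apply (rcont_refl (fun x => Im (f x)))];
    assumption.
Qed.

Lemma cjcont_mul F F' : cjcont F -> cjcont F' -> cjcont (fun x y => F x y * F' x y)%C.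
Proof.
  intros [] []; split; simpl;
    [apply (jcont_add (fun x y => fst (F x y) * fst (F' x y))); [|apply jcont_opp]|apply jcont_add];
    now apply jcont_mul.
Qed.

Lemma cjcont_fst f : ccont f -> cjcont (fun x _ => f x).
Proof.
  intros []; split; [apply (jcont_fst (fun x => Re (f x)))|apply (jcont_fst (fun x => Im (f x)))];
    assumption.
Qed.

Lemma cjcont_snd f : ccont f -> cjcont (fun _ y => f y).
Proof.
  intros []; split; [apply (jcont_snd (fun x => Re (f x)))|apply (jcont_snd (fun x => Im (f x)))];
    assumption.
Qed.

Lemma cjcont_sub f : ccont f -> cjcont (fun x y => f (x ⊖ y)).
Proof.
  intros []; split; [apply (jcont_sub (fun x => Re (f x)))|apply (jcont_sub (fun x => Im (f x)))];
    assumption.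
Qed.

Lemma cjcont_row F x : cjcont F -> ccont (F x).
Proof.
  intros []; split; [apply (jcont_row (fun x y => Re (F x y)))|apply (jcont_row (fun x y => Im (F x y)))];
    assumption.
Qed.

Lemma ccont_Mc F : cjcont F -> ccont (fun x => Mc (F x)).
Proof. intros []; split; apply rcont_M; assumption. Qed.

Lemma Mc_fubini F : cjcont F ->
  Mc (fun y => Mc (F y)) = Mc (fun z => Mc (fun y => F y z)).
Proof.
  intros []. unfold Mc at 1 3; simpl. f_equal.
  - now apply (M_fubini (fun x y => Re (F x y))).
  - now apply (M_fubini (fun x y => Im (F x y))).
Qed.

Lemma Mc_add f g : ccont f -> ccont g -> Mc (fun x => f x + g x)%C = (Mc f + Mc g)%C.
Proof. intros [] []. apply C_ext; simpl; now apply M_add. Qed.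

Lemma Mc_scal c f : ccont f -> Mc (fun x => c * f x)%C = (c * Mc f)%C.
Proof.
  intros []. apply C_ext; simpl.
  - rewrite M_sub, !M_scal; auto using rcont_scal.
  - rewrite M_add, !M_scal; auto using rcont_scal.
Qed.

Lemma Mc_conj f : ccont f -> Mc (fun x => Cconj (f x)) = Cconj (Mc f).
Proof. intros []. apply C_ext; simpl; [reflexivity|now apply M_opp]. Qed.

Lemma Mc_neg f : ccont f -> Mc (fun x => f (⊖ x)) = Mc f.
Proof.
  intros []. apply C_ext; simpl;
    [apply (M_neg (fun x => Re (f x)))|apply (M_neg (fun x => Im (f x)))]; assumption.
Qed.

Lemma Mc_tr f a : ccont f -> Mc (fun x => f (x ⊕ a)) = Mc f.
Proof.
  intros []. apply C_ext; simpl;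
    [apply (M_tr (fun x => Re (f x)))|apply (M_tr (fun x => Im (f x)))]; assumption.
Qed.

Lemma Mc_refl f a : ccont f -> Mc (fun x => f (a ⊖ x)) = Mc f.
Proof.
  intros Hf. rewrite <- (Mc_neg f Hf), <- (Mc_tr (fun x => f (⊖ x)) (⊖ a)) by now apply ccont_neg.
  f_equal. apply functional_extensionality; intros x. f_equal; agroup.
Qed.

Lemma Im_le_Cmod z : Rabs (Im z) <= Cmod z.
Proof. eapply Rle_trans; [apply Rmax_r|apply Rmax_Cmod]. Qed.

Lemma Cmod_le_sum z : Cmod z <= Rabs (Re z) + Rabs (Im z).
Proof.
  destruct z as [a b]. replace ((a, b) : C) with (RtoC a + Ci * RtoC b)%C
    by (apply C_ext; simpl; ring).
  eapply Rle_trans; [apply Cmod_triangle|].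
  rewrite Cmod_mult, Cmod_Ci, !Cmod_R. simpl. right.
  rewrite Rmult_1_l. f_equal; f_equal; ring.
Qed.

(** The factor [2] comes from treating real and imaginary parts separately; a crude constant
    suffices for continuity of convolution. *)
Lemma Mc_bound f B : ccont f -> (forall x, Cmod (f x) <= B) -> Cmod (Mc f) <= 2 * B.
Proof.
  intros [H1 H2] H. eapply Rle_trans; [apply Cmod_le_sum|]. simpl.
  assert (Rabs (M (fun x => Re (f x))) <= B).
  { apply M_abs_le; [assumption|]. intros x. eapply Rle_trans; [apply re_le_Cmod|auto]. }
  assert (Rabs (M (fun x => Im (f x))) <= B).
  { apply M_abs_le; [assumption|]. intros x. eapply Rle_trans; [apply Im_le_Cmod|auto]. }
  lra.
Qed.

(** Bundling continuity makes the laws of the convolution algebra plain equations, usable for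
    rewriting without side conditions. *)
Record CF := mkCF { cf :> G -> C ; cf_cont : ccont cf }.

Lemma CF_ext (f g : CF) : (forall x, f x = g x) -> f = g.
Proof.
  destruct f as [f Hf], g as [g Hg]; simpl; intros H.
  assert (f = g) by now apply functional_extensionality. subst g.
  f_equal. apply proof_irrelevance.
Qed.

Definition cadd (f g : CF) : CF := mkCF _ (ccont_add f g (cf_cont f) (cf_cont g)).
Definition cscal (c : C) (f : CF) : CF := mkCF _ (ccont_scal c f (cf_cont f)).
Definition ctr (a : G) (f : CF) : CF := mkCF _ (ccont_tr f a (cf_cont f)).
(** The involution of the group algebra: [f^~ = f] says that convolution by [f] is self-adjoint. *)
Definition cstar (f : CF) : CF :=
  mkCF (fun x => Cconj (f (⊖ x))) (ccont_conj _ (ccont_neg f (cf_cont f))).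

Lemma conv_kernel (f g : CF) : cjcont (fun x y => f (x ⊖ y) * g y)%C.
Proof.
  apply (cjcont_mul (fun x y => f (x ⊖ y)) (fun _ y => g y)).
  - apply cjcont_sub, cf_cont.
  - apply cjcont_snd, cf_cont.
Qed.

Definition conv (f g : CF) : CF :=
  mkCF (fun x => Mc (fun y => f (x ⊖ y) * g y)%C) (ccont_Mc _ (conv_kernel f g)).

Local Notation "f ∗ g" := (conv f g) (at level 40, left associativity).
Local Notation "f ∔ g" := (cadd f g) (at level 50, left associativity).
Local Notation "c ∙ f" := (cscal c f) (at level 38, right associativity).
Local Notation "f ^~" := (cstar f) (at level 30, format "f ^~").

Lemma conv_comm f g : f ∗ g = g ∗ f.
Proof.
  apply CF_ext; intros x; simpl.
  rewrite <- (Mc_refl (fun y => f (x ⊖ y) * g y)%C x) by (apply (cjcont_row _ x (conv_kernel f g))).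
  f_equal; apply functional_extensionality; intros y.
  replace (x ⊖ (x ⊖ y)) with y by agroup. ring.
Qed.

Lemma conv_assoc f g h : f ∗ (g ∗ h) = f ∗ g ∗ h.
Proof.
  apply CF_ext; intros x; simpl.
  transitivity (Mc (fun z => Mc (fun y => f (x ⊖ z) * (g (z ⊖ y) * h y))%C)).
  { f_equal; apply functional_extensionality; intros z. symmetry. apply Mc_scal.
    exact (cjcont_row _ z (conv_kernel g h)). }
  rewrite (Mc_fubini (fun z y => f (x ⊖ z) * (g (z ⊖ y) * h y))%C).
  2:{ apply (cjcont_mul (fun z y => f (x ⊖ z)) (fun z y => g (z ⊖ y) * h y)%C).
      - apply (cjcont_fst (fun z => f (x ⊖ z))), ccont_refl, cf_cont.
      - apply conv_kernel. }
  f_equal; apply functional_extensionality; intros y.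
  rewrite (Cmult_comm _ (h y)).
  rewrite <- Mc_scal by (exact (cjcont_row _ (x ⊖ y) (conv_kernel f g))).
  rewrite <- (Mc_tr (fun z => h y * (f (x ⊖ y ⊖ z) * g z))%C (⊖ y))
    by (apply ccont_scal; exact (cjcont_row _ (x ⊖ y) (conv_kernel f g))).
  f_equal; apply functional_extensionality; intros z.
  replace (x ⊖ y ⊖ (z ⊖ y)) with (x ⊖ z) by agroup. ring.
Qed.

Lemma conv_add_l f g h : (f ∔ g) ∗ h = f ∗ h ∔ g ∗ h.
Proof.
  apply CF_ext; intros x; simpl.
  rewrite <- Mc_add by (exact (cjcont_row _ x (conv_kernel _ h))).
  f_equal; apply functional_extensionality; intros y. ring.
Qed.

Lemma conv_add_r f g h : h ∗ (f ∔ g) = h ∗ f ∔ h ∗ g.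
Proof. rewrite !(conv_comm h). apply conv_add_l. Qed.

Lemma conv_scal_l c f g : (c ∙ f) ∗ g = c ∙ (f ∗ g).
Proof.
  apply CF_ext; intros x; simpl.
  rewrite <- Mc_scal by (exact (cjcont_row _ x (conv_kernel f g))).
  f_equal; apply functional_extensionality; intros y. ring.
Qed.

Lemma conv_scal_r c f g : f ∗ (c ∙ g) = c ∙ (f ∗ g).
Proof. rewrite !(conv_comm f). apply conv_scal_l. Qed.

Lemma conv_swap f g h k : (f ∗ g) ∗ (h ∗ k) = (f ∗ h) ∗ (g ∗ k).
Proof. rewrite <- !conv_assoc. f_equal. rewrite !conv_assoc. f_equal. apply conv_comm. Qed.

Lemma ctr_conv a f g : ctr a f ∗ g = ctr a (f ∗ g).
Proof.
  apply CF_ext; intros x; simpl.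
  f_equal; apply functional_extensionality; intros y. f_equal. f_equal. agroup.
Qed.

Lemma ctr_conv_r a f g : f ∗ ctr a g = ctr a (f ∗ g).
Proof. rewrite conv_comm, ctr_conv, conv_comm. reflexivity. Qed.

Lemma ctr_opp a f : ctr a (ctr (⊖ a) f) = f.
Proof. apply CF_ext; intros x; simpl. f_equal; agroup. Qed.

Lemma star_conv f g : (f ∗ g)^~ = f^~ ∗ g^~.
Proof.
  apply CF_ext; intros x; simpl.
  rewrite <- Mc_conj by (exact (cjcont_row _ (⊖ x) (conv_kernel f g))).
  rewrite <- (Mc_neg (fun y => Cconj (f (⊖ x ⊖ y) * g y))).
  - f_equal; apply functional_extensionality; intros y.
    rewrite Cmult_conj. f_equal. f_equal. f_equal. agroup.
  - apply ccont_conj. exact (cjcont_row _ (⊖ x) (conv_kernel f g)).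
Qed.

Lemma star_add f g : (f ∔ g)^~ = f^~ ∔ g^~.
Proof. apply CF_ext; intros x; simpl. apply Cplus_conj. Qed.

Lemma star_scal c f : (c ∙ f)^~ = Cconj c ∙ f^~.
Proof. apply CF_ext; intros x; simpl. apply Cmult_conj. Qed.

Lemma star_scal_R (r : R) f : (r ∙ f)^~ = r ∙ f^~.
Proof. rewrite star_scal. f_equal. apply C_ext; simpl; ring. Qed.

Lemma star_star f : f^~^~ = f.
Proof.
  apply CF_ext; intros x; simpl. rewrite Cconj_conj. f_equal. agroup.
Qed.

Lemma star_tr a f : (ctr a f)^~ = ctr (⊖ a) (f^~).
Proof. apply CF_ext; intros x; simpl. f_equal. f_equal. agroup. Qed.

Lemma star_e0 f : f^~ e0 = Cconj (f e0).
Proof. simpl. f_equal. f_equal. agroup. Qed.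

(** * Positivity: convolution squares and their supremum *)

Definition N (u : CF) : R := M (fun x => Re (u x) * Re (u x) + Im (u x) * Im (u x)).

Lemma rcont_sq_norm (u : CF) : rcont (fun x => Re (u x) * Re (u x) + Im (u x) * Im (u x)).
Proof. destruct (cf_cont u). apply rcont_add; now apply rcont_mul. Qed.

(** Inner products occur only in this guise, as values at [0] of [u ∗ v^~]; [N] is the squared
    mean-square norm. *)
Lemma conv_star_e0 u : (u ∗ u^~) e0 = RtoC (N u).
Proof.
  simpl. rewrite <- (Mc_neg (fun y => u (e0 ⊖ y) * Cconj (u (⊖ y)))%C)
    by (exact (cjcont_row _ e0 (conv_kernel u (u^~)))).
  replace (fun x => (u (e0 ⊖ ⊖ x) * Cconj (u (⊖ ⊖ x)))%C)
    with (fun x => RtoC (Re (u x) * Re (u x) + Im (u x) * Im (u x))).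
  - apply C_ext; simpl; [reflexivity|apply M_const].
  - apply functional_extensionality; intros x.
    replace (e0 ⊖ ⊖ x) with x by agroup. replace (⊖ ⊖ x) with x by agroup.
    apply C_ext; simpl; unfold Re, Im; ring.
Qed.

Lemma N_ge0 u : 0 <= N u.
Proof. apply M_ge0; [apply rcont_sq_norm|]. intros x; nra. Qed.

Lemma N_gt0 (u : CF) x : u x <> 0%C -> 0 < N u.
Proof.
  intros Hx. apply (M_gt0 _ x); [apply rcont_sq_norm|intros y; nra|].
  apply Rnot_le_lt. intros H. apply Hx. apply C_ext; simpl; nra.
Qed.

(* The Cauchy-Schwarz inequality, in its additive form. *)
Lemma positive_functional_bound (L : CF -> C) :
  (forall f g, L (f ∔ g) = (L f + L g)%C) ->
  (forall c f, L (c ∙ f) = (c * L f)%C) ->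
  (forall f, L (f^~) = Cconj (L f)) ->
  (forall u, 0 <= Re (L (u ∗ u^~))) ->
  forall u v, 2 * Cmod (L (u ∗ v^~)) <= Re (L (u ∗ u^~)) + Re (L (v ∗ v^~)).
Proof.
  intros Ladd Lscal Lstar Lpos u v.
  set (z := L (u ∗ v^~)).
  assert (Hvu : L (v ∗ u^~) = Cconj z).
  { unfold z. rewrite <- Lstar, star_conv, star_star, conv_comm. reflexivity. }
  destruct (classic (z = 0%C)) as [->|Hz].
  { rewrite Cmod_0. pose proof (Lpos u). pose proof (Lpos v). lra. }
  assert (Hm : 0 < Cmod z) by now apply Cmod_gt_0.
  (* The phase for which both cross terms of [(u + c v) ∗ (u + c v)^~] become [-Cmod z]. *)
  set (c := (- (z / Cmod z))%C).
  specialize (Lpos (u ∔ c ∙ v)).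
  rewrite star_add, star_scal, !conv_add_l, !conv_add_r, !Ladd, !conv_scal_l, !conv_scal_r, !Lscal,
    Hvu in Lpos.
  fold z in Lpos.
  assert (Hr : RtoC (Cmod z) <> 0%C) by (intros H; apply RtoC_inj in H; lra).
  assert (Hzz : (z * Cconj z = RtoC (Cmod z) * RtoC (Cmod z))%C).
  { rewrite <- Cmod2_conj. rewrite RtoC_pow. simpl. ring. }
  assert (Hcc : Cconj c = (- (Cconj z / Cmod z))%C).
  { unfold c. rewrite Copp_conj, Cdiv_conj by exact Hr. f_equal. f_equal.
    apply C_ext; simpl; ring. }
  assert (H1 : (Cconj c * z = - RtoC (Cmod z))%C).
  { rewrite Hcc. replace (- (Cconj z / Cmod z) * z)%C with (- (z * Cconj z) / Cmod z)%C
      by (field; exact Hr). rewrite Hzz. field. exact Hr. }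
  assert (H2 : (c * Cconj z = - RtoC (Cmod z))%C).
  { unfold c. replace (- (z / Cmod z) * Cconj z)%C with (- (z * Cconj z) / Cmod z)%C
      by (field; exact Hr). rewrite Hzz. field. exact Hr. }
  assert (H3 : (c * (Cconj c * L (v ∗ v^~)) = L (v ∗ v^~))%C).
  { rewrite Cmult_assoc. replace (c * Cconj c)%C with (RtoC 1); [ring|].
    rewrite Hcc. unfold c.
    replace (- (z / Cmod z) * - (Cconj z / Cmod z))%C
      with ((z * Cconj z) / (Cmod z * Cmod z))%C by (field; exact Hr).
    rewrite Hzz. field. exact Hr. }
  rewrite H1, H2, H3 in Lpos.
  rewrite !re_plus, !re_opp, !re_RtoC in Lpos. lra.
Qed.

Definition Sq (f : CF) : Prop := exists w, f = w ∗ w^~.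

Lemma Sq_conv f g : Sq f -> Sq g -> Sq (f ∗ g).
Proof.
  intros [v ->] [w ->]. exists (v ∗ w). rewrite star_conv. apply conv_swap.
Qed.

Lemma Sq_star f : Sq f -> f^~ = f.
Proof. intros [v ->]. rewrite star_conv, star_star. apply conv_comm. Qed.

Lemma Sq_ge0 f : Sq f -> 0 <= Re (f e0).
Proof. intros [v ->]. rewrite conv_star_e0. simpl. apply N_ge0. Qed.

(** Cauchy-Schwarz for the positive functional [L h = (h - k ∗ h) e0], applied to [ctr x u] and [u]:
    the translate [ctr x u] has the same convolution square as [u], and [ctr x u ∗ u^~] at [0] is
    [f] at [x]. A gap at the single point [0] thus bounds the gap everywhere. *)
Lemma Sq_gap_bound k f : k^~ = k -> Sq f ->
  (forall u, Re ((k ∗ (u ∗ u^~)) e0) <= Re ((u ∗ u^~) e0)) ->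
  forall x, Cmod (f x - (k ∗ f) x) <= Re (f e0) - Re ((k ∗ f) e0).
Proof.
  intros Hk [u ->] Hpos x.
  set (L := fun h : CF => (h e0 - (k ∗ h) e0)%C).
  assert (H := positive_functional_bound L).
  assert (HL : forall h, L (ctr x h) = (h x - (k ∗ h) x)%C).
  { intros h. unfold L. rewrite ctr_conv_r. simpl. now rewrite (g0l G (proj1 HG)). }
  rewrite <- HL, <- ctr_conv.
  assert (Hu : ctr x u ∗ (ctr x u)^~ = u ∗ u^~).
  { rewrite star_tr, ctr_conv, ctr_conv_r, ctr_opp. reflexivity. }
  specialize (fun A B D E => H A B D E (ctr x u) u). rewrite Hu in H.
  assert (H' : 2 * Cmod (L (ctr x u ∗ u^~)) <= Re (L (u ∗ u^~)) + Re (L (u ∗ u^~))).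
  { apply H.
    - intros f g. unfold L. rewrite conv_add_r. simpl. ring.
    - intros c f. unfold L. rewrite conv_scal_r. simpl. ring.
    - intros f. unfold L. rewrite <- Hk at 1. rewrite <- star_conv, !star_e0, Cminus_conj. reflexivity.
    - intros v. unfold L. specialize (Hpos v). unfold Cminus. rewrite re_plus, re_opp. lra. }
  unfold L in H' at 2 3. unfold Cminus in H'. rewrite re_plus, re_opp in H'. lra.
Qed.

Lemma Sq_bound f x : Sq f -> Cmod (f x) <= Re (f e0).
Proof.
  intros Hf.
  assert (H0 : forall h y, (((RtoC 0) ∙ f) ∗ h) y = RtoC 0).
  { intros h y. rewrite conv_scal_l. simpl. ring. }
  (* The case [k = 0], with [RtoC 0 ∙ f] as the zero function. *)
  pose proof (Sq_gap_bound (RtoC 0 ∙ f) f) as H.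
  assert (H' : Cmod (f x - ((RtoC 0 ∙ f) ∗ f) x) <= Re (f e0) - Re (((RtoC 0 ∙ f) ∗ f) e0)).
  { apply H; [|exact Hf|].
    - rewrite star_scal_R. apply CF_ext; intros y. simpl. ring.
    - intros u. rewrite H0. rewrite conv_star_e0. simpl. apply N_ge0. }
  rewrite !H0 in H'. replace (f x - 0)%C with (f x) in H' by ring. simpl in H'.
  unfold Re in *. lra.
Qed.

Lemma Sq_conv_le f g : Sq f -> Sq g -> Re ((f ∗ g) e0) <= Re (f e0) * Re (g e0).
Proof.
  intros Hf Hg. rewrite <- (M_const (Re (f e0) * Re (g e0))).
  change (M (fun y => Re (f (e0 ⊖ y) * g y)%C) <= M (fun _ => Re (f e0) * Re (g e0))).
  apply M_le; [apply (proj1 (cjcont_row _ e0 (conv_kernel f g)))|apply rcont_const|].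
  intros y. eapply Rle_trans; [apply Rle_abs|]. eapply Rle_trans; [apply re_le_Cmod|].
  rewrite Cmod_mult. apply Rmult_le_compat; auto using Cmod_ge_0, Sq_bound.
Qed.

(** * Uniform estimates and uniform limits *)

Lemma ccont_bounded f : ccont f -> exists B, 0 <= B /\ forall x, Cmod (f x) <= B.
Proof.
  intros [H1 H2]. destruct (rcont_bounded _ H1) as (B1 & ? & HB1).
  destruct (rcont_bounded _ H2) as (B2 & ? & HB2).
  exists (B1 + B2); split; [lra|]. intros x. eapply Rle_trans; [apply Cmod_le_sum|].
  specialize (HB1 x). specialize (HB2 x). simpl in *. lra.
Qed.

Lemma conv_sup_bound (g : CF) : exists B, 0 <= B /\
  forall (h : CF) e, (forall y, Cmod (h y) <= e) -> forall x, Cmod ((g ∗ h) x) <= B * e.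
Proof.
  destruct (ccont_bounded g (cf_cont g)) as (B & HB0 & HB).
  exists (2 * B); split; [lra|]. intros h e He x.
  rewrite Rmult_assoc. apply Mc_bound; [exact (cjcont_row _ x (conv_kernel g h))|].
  intros y. rewrite Cmod_mult. apply Rmult_le_compat; auto using Cmod_ge_0.
Qed.

Lemma Cmod_small_eq (z w : C) (B : R) :
  (forall eps, 0 < eps -> Cmod (z - w) <= B * eps) -> z = w.
Proof.
  intros H. assert (Hm : Cmod (z - w) = 0).
  { apply Rle_antisym; [|apply Cmod_ge_0]. apply Rnot_lt_le. intros Hlt.
    pose proof (Rabs_pos B). pose proof (Rle_abs B).
    specialize (H (Cmod (z - w) / (2 * (Rabs B + 1)))).
    assert (Hd : 0 < Cmod (z - w) / (2 * (Rabs B + 1))) by (apply Rdiv_lt_0_compat; lra).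
    specialize (H Hd). set (d := Cmod (z - w) / (2 * (Rabs B + 1))) in *.
    assert (Cmod (z - w) = d * (2 * (Rabs B + 1))) by (unfold d; field; lra).
    nra. }
  apply Cmod_eq_0 in Hm. replace z with (z - w + w)%C by ring. rewrite Hm. ring.
Qed.

Lemma R_limit_rate (r e : nat -> R) :
  (forall n m, (n <= m)%nat -> Rabs (r n - r m) <= e n) ->
  (forall eps, 0 < eps -> exists n, e n <= eps) ->
  exists l, forall n, Rabs (r n - l) <= e n.
Proof.
  intros Hr He. assert (Hc : Cauchy_crit r).
  { intros eps Heps. destruct (He (eps / 3)) as (n & Hn); [lra|].
    exists n. intros p q Hp Hq. unfold Rdist.
    pose proof (Hr n p Hp) as H1. pose proof (Hr n q Hq) as H2.
    apply Rabs_le_between in H1, H2. apply Rabs_def1; lra. }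
  destruct (Rcomplete.R_complete r Hc) as (l & Hl). exists l. intros n.
  apply Rnot_lt_le. intros Hlt.
  destruct (Hl (Rabs (r n - l) - e n)) as (m & Hm); [lra|].
  specialize (Hm (max n m) ltac:(lia)). unfold Rdist in Hm.
  pose proof (Hr n (max n m) ltac:(lia)) as H1.
  assert (Rabs (r n - l) <= Rabs (r n - r (max n m)) + Rabs (r (max n m) - l)).
  { replace (r n - l) with ((r n - r (max n m)) + (r (max n m) - l)) by ring. apply Rabs_triang. }
  lra.
Qed.

Lemma rcont_limit (f : nat -> G -> R) (g : G -> R) (e : nat -> R) :
  (forall n, rcont (f n)) -> (forall n x, Rabs (f n x - g x) <= e n) ->
  (forall eps, 0 < eps -> exists n, e n <= eps) -> rcont g.
Proof.
  intros Hf Hg He eps Heps. destruct (He (eps / 3)) as (n & Hn); [lra|].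
  destruct (Hf n (eps / 3)) as (V & HV & H); [lra|].
  exists V; split; [exact HV|]. intros x y Hxy. specialize (H x y Hxy).
  pose proof (Hg n x) as H1. pose proof (Hg n y) as H2.
  apply Rabs_le_between in H, H1, H2. apply Rabs_le; lra.
Qed.

Lemma CF_limit (f : nat -> CF) (e : nat -> R) :
  (forall n m x, (n <= m)%nat -> Cmod (f n x - f m x) <= e n) ->
  (forall eps, 0 < eps -> exists n, e n <= eps) ->
  exists g : CF, forall n x, Cmod (f n x - g x) <= 2 * e n.
Proof.
  intros Hf He.
  assert (H1 : forall x, exists l, forall n, Rabs (Re (f n x) - l) <= e n).
  { intros x. apply R_limit_rate; [|exact He]. intros n m Hnm.
    replace (Re (f n x) - Re (f m x)) with (Re (f n x - f m x)%C) by (simpl; unfold Re; ring).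
    eapply Rle_trans; [apply re_le_Cmod|auto]. }
  assert (H2 : forall x, exists l, forall n, Rabs (Im (f n x) - l) <= e n).
  { intros x. apply R_limit_rate; [|exact He]. intros n m Hnm.
    replace (Im (f n x) - Im (f m x)) with (Im (f n x - f m x)%C) by (simpl; unfold Im; ring).
    eapply Rle_trans; [apply Im_le_Cmod|auto]. }
  destruct (choice _ H1) as (g1 & Hg1). destruct (choice _ H2) as (g2 & Hg2).
  assert (Hc : ccont (fun x => (g1 x, g2 x))).
  { split; simpl.
    - apply (rcont_limit (fun n x => Re (f n x)) g1 e); auto. intros n; apply (cf_cont (f n)).
    - apply (rcont_limit (fun n x => Im (f n x)) g2 e); auto. intros n; apply (cf_cont (f n)). }
  exists (mkCF _ Hc). intros n x. eapply Rle_trans; [apply Cmod_le_sum|]. simpl.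
  specialize (Hg1 x n). specialize (Hg2 x n). unfold Re, Im, Rminus in *. lra.
Qed.

(** * Hermitian idempotents and characters *)

Lemma scal_scal c d f : c ∙ d ∙ f = (c * d)%C ∙ f.
Proof. apply CF_ext; intros x; simpl; ring. Qed.

Lemma scal_1 f : RtoC 1 ∙ f = f.
Proof. apply CF_ext; intros x; simpl; ring. Qed.

Lemma N_conv_star u v : Re ((v ∗ v^~ ∗ (u ∗ u^~)) e0) = N (v ∗ u).
Proof. rewrite conv_swap, <- star_conv, conv_star_e0. reflexivity. Qed.

(* [n |-> Re ((k^n * q) e0)] is convex. *)
Lemma Sq_convex k q : k^~ = k -> Sq q ->
  0 <= Re (q e0) - 2 * Re ((k ∗ q) e0) + Re ((k ∗ (k ∗ q)) e0).
Proof.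
  intros Hk [v ->].
  (* The second difference is [N (v - k ∗ v)]. *)
  set (w := v ∔ RtoC (-1) ∙ (k ∗ v)).
  replace (_ - _ + _) with (Re ((w ∗ w^~) e0)).
  - apply Sq_ge0. now exists w.
  - unfold w. rewrite star_add, star_scal_R, star_conv, Hk.
    rewrite !conv_add_l, !conv_add_r, !conv_scal_l, !conv_scal_r.
    replace (v ∗ (k ∗ v^~)) with (k ∗ (v ∗ v^~)).
    2:{ rewrite !conv_assoc, (conv_comm k v). reflexivity. }
    rewrite <- conv_assoc.
    replace (k ∗ v ∗ (k ∗ v^~)) with (k ∗ (k ∗ (v ∗ v^~))).
    2:{ rewrite conv_swap, !conv_assoc. reflexivity. }
    set (a := v ∗ v^~). set (b := k ∗ a). set (c := k ∗ b).
    simpl. unfold Re. simpl. ring.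
Qed.

Section PowerIteration.
Variable phi : CF.
Hypothesis phi_star : phi^~ = phi.
Variable x0 : G.
Hypothesis phi_x0 : phi x0 <> 0%C.

Let kappa : CF := phi ∗ phi.

Lemma kappa_Sq : Sq kappa.
Proof. exists phi. now rewrite phi_star. Qed.

(** Since [phi] is hermitian, the quotient is [N (phi ∗ u) / N u], so [mu] is the squared operator
    norm of convolution by [phi]. It is at most [kappa e0] by [Sq_conv_le]. It is positive because
    [phi] is a test function: [phi ∗ phi] has the value [N phi] at [0]. The supremum need not be
    known to be attained. *)
Lemma rayleigh_sup : exists mu, 0 < mu /\
  (forall u, Re ((kappa ∗ (u ∗ u^~)) e0) <= mu * N u) /\
  (forall eta, 0 < eta -> exists u, 0 < N u /\ (mu - eta) * N u < Re ((kappa ∗ (u ∗ u^~)) e0)).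
Proof.
  set (K := fun u => Re ((kappa ∗ (u ∗ u^~)) e0)).
  assert (HK : forall u, K u <= Re (kappa e0) * N u).
  { intros u. replace (N u) with (Re ((u ∗ u^~) e0)) by now rewrite conv_star_e0.
    apply Sq_conv_le; [apply kappa_Sq|now exists u]. }
  set (E := fun r => exists u, 0 < N u /\ r * N u = K u).
  assert (Hphi : 0 < N phi) by now apply (N_gt0 phi x0).
  assert (HKphi : 0 < K phi).
  { unfold K. unfold kappa. rewrite <- phi_star at 2. rewrite N_conv_star.
    apply (N_gt0 _ e0). rewrite <- phi_star at 2. rewrite conv_star_e0.
    intros H. apply RtoC_inj in H. lra. }
  destruct (completeness E) as (mu & Hmu1 & Hmu2).
  - exists (Re (kappa e0)). intros r (u & Hu & Hr). specialize (HK u). nra.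
  - exists (K phi / N phi), phi. split; [exact Hphi|]. field. lra.
  - assert (Hpos : 0 < mu).
    { apply Rlt_le_trans with (K phi / N phi); [now apply Rdiv_lt_0_compat|].
      apply Hmu1. exists phi. split; [exact Hphi|]. field. lra. }
    exists mu; split; [exact Hpos|split].
    + intros u. fold (K u). destruct (Rle_lt_or_eq_dec 0 (N u) (N_ge0 u)) as [Hu|Hu].
      * assert (K u / N u <= mu).
        { apply Hmu1. exists u; split; [exact Hu|]. field; lra. }
        apply (Rmult_le_compat_r (N u)) in H; [|lra].
        replace (K u / N u * N u) with (K u) in H by (field; lra). exact H.
      * specialize (HK u). rewrite <- Hu in *. lra.
    + intros eta Heta. apply NNPP; intros Hn.
      assert (is_upper_bound E (mu - eta)).
      { intros r (u & Hu & Hr). apply Rnot_lt_le. intros Hlt. apply Hn.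
        exists u; split; [exact Hu|]. fold (K u). rewrite <- Hr. nra. }
      apply Hmu2 in H. lra.
Qed.

(* The powers of [phi * phi], normalised by the top eigenvalue of the convolution operator, decrease
   uniformly to the projection onto the top eigenspace. *)
Lemma top_idempotent : exists mu psi, 0 < mu /\ psi^~ = psi /\ psi ∗ psi = psi /\
  kappa ∗ psi = RtoC mu ∙ psi /\ psi e0 <> 0%C.
Proof.
  destruct rayleigh_sup as (mu & Hmu & Hle & Hsup).
  set (k := RtoC (/ mu) ∙ kappa).
  assert (Hmuk : RtoC mu ∙ k = kappa).
  { unfold k. rewrite scal_scal, <- RtoC_mult, Rinv_r, scal_1 by lra. reflexivity. }
  assert (HkSq : Sq k).
  { exists (RtoC (/ sqrt mu) ∙ phi). rewrite star_scal_R, conv_scal_l, conv_scal_r, scal_scal.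
    rewrite phi_star, <- RtoC_mult, <- Rinv_mult, sqrt_sqrt by lra. reflexivity. }
  pose proof (Sq_star k HkSq) as Hks.
  assert (HkE : forall h, Re ((k ∗ h) e0) = / mu * Re ((kappa ∗ h) e0)).
  { intros h. unfold k. rewrite conv_scal_l. simpl. unfold Re. ring. }
  assert (Hk1 : forall u, Re ((k ∗ (u ∗ u^~)) e0) <= Re ((u ∗ u^~) e0)).
  { intros u. rewrite HkE, (conv_star_e0 u), re_RtoC. specialize (Hle u).
    apply (Rmult_le_compat_l (/ mu)) in Hle; [|left; now apply Rinv_0_lt_compat].
    rewrite <- Rmult_assoc, Rinv_l, Rmult_1_l in Hle by lra. exact Hle. }
  (* [f n] is the power [n + 1] of [k]: the convolution algebra has in general no unit to start
     from. *)
  set (f := fix f n := match n with O => k | S m => k ∗ f m end).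
  assert (HfSq : forall n, Sq (f n)).
  { induction n; simpl; [exact HkSq|now apply Sq_conv]. }
  set (a := fun n => Re (f n e0)).
  assert (Hstep : forall n x, Cmod (f n x - f (S n) x) <= a n - a (S n)).
  { intros n x. apply (Sq_gap_bound k (f n) Hks (HfSq n) Hk1). }
  assert (Hcauchy : forall n m x, (n <= m)%nat -> Cmod (f n x - f m x) <= a n - a m).
  { intros n m x Hnm. induction Hnm as [|m Hnm IH].
    - replace (f n x - f n x)%C with (RtoC 0) by ring. rewrite Cmod_0. lra.
    - replace (f n x - f (S m) x)%C with ((f n x - f m x) + (f m x - f (S m) x))%C by ring.
      eapply Rle_trans; [apply Cmod_triangle|]. specialize (Hstep m x). lra. }
  (* The powers do not die out. If [a n < 1], take [u] with almost maximal quotient. The values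
     [b i] of [k^i ∗ (u ∗ u^~)] at [0] start at [N u] with a tiny first drop, yet
     [b (S n) <= a n * N u]. *)
  assert (Ha1 : forall n, 1 <= a n).
  { intros n. apply Rnot_lt_le. intros Hlt.
    pose proof (pos_INR n) as Hn.
    (* Chosen so that [n + 1] drops of size [eta / mu * N u] amount to exactly [(1 - a n) * N u]. *)
    set (eta := mu * ((1 - a n) / (INR n + 1))).
    assert (Heta : 0 < eta) by (apply Rmult_lt_0_compat; [lra|apply Rdiv_lt_0_compat; lra]).
    destruct (Hsup eta Heta) as (u & Hu & HKu).
    set (p := fix p n := match n with O => u ∗ u^~ | S m => k ∗ p m end).
    assert (HpSq : forall n, Sq (p n)).
    { induction n0; simpl; [now exists u|now apply Sq_conv]. }
    assert (Hpf : forall n, p (S n) = f n ∗ (u ∗ u^~)).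
    { induction n0 as [|m IH]; [reflexivity|].
      change (k ∗ p (S m) = k ∗ f m ∗ (u ∗ u^~)). rewrite IH. apply conv_assoc. }
    set (b := fun n => Re (p n e0)).
    (* By convexity no later drop exceeds the first. *)
    assert (Hconv : forall n, b n - b (S n) <= b O - b 1%nat).
    { induction n0 as [|m IH]; [lra|].
      pose proof (Sq_convex k (p m) Hks (HpSq m)) as H. fold (b m) in H.
      change (Re ((k ∗ p m) e0)) with (b (S m)) in H.
      change (Re ((k ∗ (k ∗ p m)) e0)) with (b (S (S m))) in H. lra. }
    assert (Hlin : forall n, b O - INR n * (b O - b 1%nat) <= b n).
    { induction n0 as [|m IH]; [simpl; lra|]. specialize (Hconv m). rewrite S_INR. lra. }
    assert (Hb0 : b O = N u) by (unfold b; simpl p; now rewrite conv_star_e0).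
    assert (Hb1 : (1 - eta / mu) * N u < b 1%nat).
    { change (b 1%nat) with (Re ((k ∗ (u ∗ u^~)) e0)). rewrite HkE.
      apply (Rmult_lt_compat_l (/ mu)) in HKu; [|now apply Rinv_0_lt_compat].
      replace ((1 - eta / mu) * N u) with (/ mu * ((mu - eta) * N u)) by (field; lra). exact HKu. }
    assert (HbS : b (S n) <= a n * N u).
    { unfold b. rewrite Hpf. eapply Rle_trans; [apply Sq_conv_le; [apply HfSq|now exists u]|].
      rewrite conv_star_e0, re_RtoC. apply Rle_refl. }
    specialize (Hlin (S n)). rewrite S_INR, Hb0 in Hlin.
    assert (Hem : eta / mu * (INR n + 1) = 1 - a n) by (unfold eta; field; lra).
    assert ((INR n + 1) * (N u - b 1%nat) < (1 - a n) * N u).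
    { rewrite <- Hem. replace (eta / mu * (INR n + 1) * N u) with ((INR n + 1) * (eta / mu * N u)) by ring.
      apply Rmult_lt_compat_l; lra. }
    lra. }
  assert (Hlim : exists al, (forall n, al <= a n) /\ forall eps, 0 < eps -> exists n, a n - al <= eps).
  { destruct (R_inf (fun t => exists n, t = a n)) as (t & Ht1 & Ht2).
    - exists 1. intros t (n & ->). apply Ha1.
    - now exists (a O), O.
    - exists t; split; [intros n; apply Ht1; now exists n|].
      intros eps He. destruct (Ht2 eps He) as (s & (n & ->) & Hn). exists n. lra. }
  destruct Hlim as (al & Hal & Halim).
  destruct (CF_limit f (fun n => a n - al)) as (psi & Hpsi).
  { intros n m x Hnm. specialize (Hcauchy n m x Hnm). specialize (Hal m). lra. }
  { exact Halim. }
  assert (Hadec : forall n, a (S n) <= a n).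
  { intros n. specialize (Hstep n e0). pose proof (Cmod_ge_0 (f n e0 - f (S n) e0)). lra. }
  assert (Hpsis : psi^~ = psi).
  { apply CF_ext; intros x. apply Cmod_small_eq with 4. intros eps He.
    destruct (Halim eps He) as (n & Hn).
    assert (Hfs : f n x = Cconj (f n (⊖ x))).
    { rewrite <- (Sq_star _ (HfSq n)) at 1. reflexivity. }
    replace (psi^~ x - psi x)%C
      with (- Cconj (f n (⊖ x) - psi (⊖ x)) + (f n x - psi x))%C
      by (rewrite Hfs, Cminus_conj; simpl; ring).
    eapply Rle_trans; [apply Cmod_triangle|]. rewrite Cmod_opp, Cmod_conj.
    pose proof (Hpsi n x). pose proof (Hpsi n (⊖ x)). lra. }
  assert (Hminus : forall n y, (psi ∔ RtoC (-1) ∙ f n) y = (psi y - f n y)%C) by (intros; simpl; ring).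
  assert (Hclose : forall n y, Cmod ((psi ∔ RtoC (-1) ∙ f n) y) <= 2 * (a n - al)).
  { intros n y. rewrite Hminus. replace (psi y - f n y)%C with (- (f n y - psi y))%C by ring.
    rewrite Cmod_opp. apply Hpsi. }
  assert (Hconvd : forall g n x, ((g ∗ psi) x - (g ∗ f n) x)%C = (g ∗ (psi ∔ RtoC (-1) ∙ f n)) x).
  { intros g n x. rewrite conv_add_r, conv_scal_r. simpl. ring. }
  assert (Hkpsi : k ∗ psi = psi).
  { destruct (conv_sup_bound k) as (B & HB0 & HB).
    apply CF_ext; intros x. apply Cmod_small_eq with (2 * B + 2). intros eps He.
    destruct (Halim eps He) as (n & Hn).
    replace ((k ∗ psi) x - psi x)%C with (((k ∗ psi) x - (k ∗ f n) x) + (f (S n) x - psi x))%C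
      by (simpl; ring).
    eapply Rle_trans; [apply Cmod_triangle|]. rewrite Hconvd.
    specialize (HB _ _ (Hclose n) x). specialize (Hpsi (S n) x). specialize (Hadec n).
    assert (B * (2 * (a n - al)) <= B * (2 * eps)) by (apply Rmult_le_compat_l; lra). lra. }
  assert (Hfpsi : forall n, f n ∗ psi = psi).
  { induction n as [|n IH]; [exact Hkpsi|].
    change (k ∗ f n ∗ psi = psi). rewrite <- conv_assoc, IH. exact Hkpsi. }
  exists mu, psi. repeat split; auto.
  - destruct (conv_sup_bound psi) as (B & HB0 & HB).
    apply CF_ext; intros x. apply Cmod_small_eq with (2 * B). intros eps He.
    destruct (Halim eps He) as (n & Hn).
    (* Every power of [k] fixes [psi], and [psi ∗ f n] tends to [psi ∗ psi]. *)
    rewrite <- (Hfpsi n) at 3. rewrite (conv_comm (f n)), Hconvd.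
    specialize (HB _ _ (Hclose n) x).
    assert (B * (2 * (a n - al)) <= B * (2 * eps)) by (apply Rmult_le_compat_l; lra). lra.
  - rewrite <- Hmuk, conv_scal_l, Hkpsi. reflexivity.
  (* If [psi e0 = 0], then [a n] is at most the error [2 * (1 / 4)], against [1 <= a n]. *)
  - intros H0. destruct (Halim (1 / 4)) as (n & Hn); [lra|].
    specialize (Hpsi n e0). rewrite H0 in Hpsi.
    replace (f n e0 - 0)%C with (f n e0) in Hpsi by ring.
    pose proof (re_le_Cmod (f n e0)) as H1. fold (a n) in H1.
    pose proof (Rle_abs (a n)). specialize (Ha1 n). lra.
Qed.

End PowerIteration.

Definition idem (psi : CF) : Prop := psi^~ = psi /\ psi ∗ psi = psi.

Lemma idem_Sq psi : idem psi -> Sq psi.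
Proof. intros [H1 H2]. exists psi. now rewrite H1, H2. Qed.

(** The number [psi e0] equals [N psi], hence is positive, and as the value at [0] of [psi ∗ psi] it
    is at most its own square. *)
Lemma idem_ge1 psi x : idem psi -> psi x <> 0%C -> 1 <= Re (psi e0).
Proof.
  intros H Hx. pose proof (idem_Sq _ H) as HS.
  pose proof (Sq_conv_le psi psi HS HS) as Hle. destruct H as [H1 H2]. rewrite H2 in Hle.
  assert (0 < Re (psi e0)).
  { rewrite <- H2. rewrite <- H1 at 2. rewrite conv_star_e0. apply (N_gt0 psi x Hx). }
  nra.
Qed.

(** The order on idempotents is [rho ∗ psi = rho]. Nonvanishing is tested at [0], where an
    idempotent has its largest modulus. *)
Definition minimal_idem (psi : CF) : Prop :=
  forall rho, idem rho -> rho e0 <> 0%C -> rho ∗ psi = rho -> rho = psi.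

(* If [rho < psi] then [psi - rho] is an idempotent, so the value at [0] drops by at least [1]. *)
Lemma minimal_idem_exists psi0 : idem psi0 -> psi0 e0 <> 0%C ->
  exists psi, idem psi /\ psi e0 <> 0%C /\ psi ∗ psi0 = psi /\ minimal_idem psi.
Proof.
  assert (H : forall n (psi0 : CF), Re (psi0 e0) < INR n -> idem psi0 -> psi0 e0 <> 0%C ->
    exists psi, idem psi /\ psi e0 <> 0%C /\ psi ∗ psi0 = psi /\ minimal_idem psi).
  { clear psi0. induction n as [|n IH]; intros psi0 Hn Hi H0.
    - pose proof (idem_ge1 _ _ Hi H0). simpl in Hn. lra.
    - destruct (classic (minimal_idem psi0)) as [Hm|Hm].
      + exists psi0. split; [exact Hi|split; [exact H0|split; [apply Hi|exact Hm]]].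
      + apply not_all_ex_not in Hm as (rho & Hm).
        apply imply_to_and in Hm as (Hr & Hm). apply imply_to_and in Hm as (Hr0 & Hm).
        apply imply_to_and in Hm as (Hrp & Hm).
        set (d := psi0 ∔ RtoC (-1) ∙ rho).
        assert (Hd : idem d).
        { destruct Hi as [Hi1 Hi2], Hr as [Hr1 Hr2]. unfold d. split.
          - rewrite star_add, star_scal_R, Hi1, Hr1. reflexivity.
          - rewrite conv_add_l, !conv_add_r, !conv_scal_l, !conv_scal_r.
            rewrite (conv_comm psi0 rho), Hrp, Hi2, Hr2. apply CF_ext; intros x; simpl. ring. }
        assert (Hdx : exists x, d x <> 0%C).
        { apply NNPP; intros Hnx. apply Hm. apply CF_ext; intros x.
          assert (Hx : d x = 0%C) by (apply NNPP; intros Hx; apply Hnx; now exists x).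
          unfold d in Hx. simpl in Hx. replace (rho x) with (psi0 x - (psi0 x + -1 * rho x))%C by ring.
          rewrite Hx. ring. }
        destruct Hdx as (x & Hx). pose proof (idem_ge1 d x Hd Hx) as Hge.
        destruct (IH rho) as (psi & Hp1 & Hp2 & Hp3 & Hp4); auto.
        { unfold d in Hge. simpl in Hge. rewrite S_INR in Hn. unfold Re in *. simpl in Hge. lra. }
        exists psi. split; [exact Hp1|split; [exact Hp2|split; [|exact Hp4]]].
        rewrite <- Hp3, <- conv_assoc, Hrp. reflexivity. }
  intros Hi H0. destruct (INR_unbounded (Re (psi0 e0))) as (n & Hn).
  now apply (H n).
Qed.

(** The top idempotent of [phi ∗ phi] lies below [psi], hence equals it, and the eigenvalue equation
    reads [phi ∗ phi = mu ∙ psi]. Squares being scalar multiples of [psi], expanding the square of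
    [psi + phi] isolates [2 phi]. *)
Lemma minimal_idem_scalar psi phi : idem psi -> minimal_idem psi ->
  phi^~ = phi -> phi ∗ psi = phi -> exists r : R, phi = RtoC r ∙ psi.
Proof.
  intros Hi Hm.
  assert (Hsq : forall phi, phi^~ = phi -> phi ∗ psi = phi -> exists r : R, phi ∗ phi = RtoC r ∙ psi).
  { clear phi. intros phi Hs Hp. destruct (classic (exists x, phi x <> 0%C)) as [[x Hx]|Hn].
    - destruct (top_idempotent phi Hs x Hx) as (mu & rho & Hmu & Hr1 & Hr2 & Hr3 & Hr0).
      assert (Hmu' : RtoC mu <> 0%C) by (intros H; apply RtoC_inj in H; lra).
      assert (Hrho : rho = RtoC (/ mu) ∙ (phi ∗ phi ∗ rho)).
      { rewrite Hr3, scal_scal, <- RtoC_mult, Rinv_l, scal_1 by lra. reflexivity. }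
      assert (rho = psi) as ->.
      { apply Hm; [now split|exact Hr0|]. rewrite Hrho at 1. rewrite Hrho at 2.
        rewrite conv_scal_l. f_equal. rewrite <- conv_assoc, (conv_comm rho psi).
        rewrite conv_assoc. f_equal. rewrite <- conv_assoc, Hp. reflexivity. }
      exists mu. rewrite <- Hr3, <- conv_assoc, Hp. reflexivity.
    - exists 0. assert (Hz : phi = RtoC 0 ∙ psi).
      { apply CF_ext; intros x. simpl. rewrite Cmult_0_l. apply NNPP; intros Hx. apply Hn.
        now exists x. }
      rewrite Hz at 1. rewrite conv_scal_l. apply CF_ext; intros x; simpl; ring. }
  intros Hs Hp. destruct Hi as [Hi1 Hi2].
  destruct (Hsq phi Hs Hp) as (r & Hr).
  destruct (Hsq (psi ∔ phi)) as (s & Hs').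
  - rewrite star_add, Hi1, Hs. reflexivity.
  - rewrite conv_add_l, Hi2, Hp. reflexivity.
  - exists ((s - 1 - r) / 2). rewrite conv_add_l, !conv_add_r, Hi2, Hr, (conv_comm psi), Hp in Hs'.
    apply CF_ext; intros x. apply (f_equal (fun h : CF => h x)) in Hs'. simpl in Hs' |- *.
    assert (H2 : (2 * phi x = (RtoC s - 1 - RtoC r) * psi x)%C).
    { replace (2 * phi x)%C with (psi x + phi x + (phi x + RtoC r * psi x) - psi x - RtoC r * psi x)%C by ring.
      rewrite Hs'. ring. }
    rewrite RtoC_div, !RtoC_minus by lra.
    replace (phi x) with (/ 2 * (2 * phi x))%C by field.
    rewrite H2. field.
Qed.

(** A translate is not hermitian, since the involution turns [a] into [⊖ a]. The scalar lemma is
    applied to the hermitian functions [psi_a + psi_(-a)] and [i (psi_a - psi_(-a))], from which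
    [psi_a] is recovered. *)
Lemma minimal_idem_translate psi a : idem psi -> minimal_idem psi ->
  exists c : C, ctr a psi = c ∙ psi.
Proof.
  intros Hi Hm. destruct Hi as [Hi1 Hi2].
  assert (Hoo : forall b, ⊖ ⊖ b = b) by (intros; agroup).
  destruct (minimal_idem_scalar psi (ctr a psi ∔ ctr (⊖ a) psi)) as (r & Hr); auto.
  - now split.
  - rewrite star_add, !star_tr, Hi1, Hoo. apply CF_ext; intros x; simpl; ring.
  - rewrite conv_add_l, !ctr_conv, Hi2. reflexivity.
  - destruct (minimal_idem_scalar psi (Ci ∙ (ctr a psi ∔ RtoC (-1) ∙ ctr (⊖ a) psi))) as (s & Hs); auto.
    + now split.
    + rewrite star_scal, star_add, star_scal_R, !star_tr, Hi1, Hoo.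
      apply CF_ext; intros x; simpl. replace (Cconj Ci) with (- Ci)%C by (apply C_ext; simpl; ring).
      replace (RtoC (-1)) with (- RtoC 1)%C by (apply C_ext; simpl; ring). ring.
    + rewrite conv_scal_l, conv_add_l, conv_scal_l, !ctr_conv, Hi2. reflexivity.
    + exists ((RtoC r - Ci * RtoC s) / 2)%C. apply CF_ext; intros x.
      apply (f_equal (fun h : CF => h x)) in Hr, Hs. simpl in Hr, Hs |- *.
      set (p := psi (x ⊕ a)) in *. set (q := psi (x ⊖ a)) in *.
      replace ((RtoC r - Ci * RtoC s) / 2 * psi x)%C
        with ((RtoC r * psi x - Ci * (RtoC s * psi x)) / 2)%C by field.
      rewrite <- Hr, <- Hs.
      replace (Ci * (Ci * (p + RtoC (-1) * q)))%C with ((Ci * Ci) * (p + RtoC (-1) * q))%C by ring.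
      replace (Ci * Ci)%C with (- RtoC 1)%C by (apply C_ext; simpl; ring).
      replace (RtoC (-1)) with (- RtoC 1)%C by (apply C_ext; simpl; ring).
      field.
Qed.

Definition cchar (chi : CF) : Prop :=
  (forall x y, chi (x ⊕ y) = (chi x * chi y)%C) /\ (forall x, (chi x * Cconj (chi x) = 1)%C).

(** The minimal idempotent [psi] is taken below the top idempotent of [phi ∗ phi], where
    [phi = g ∗ g^~]. So [phi ∗ phi ∗ psi = mu ∙ psi] is not zero, whereas [g ∗ psi = 0] would
    annihilate it. Division by [psi e0] makes the translation scalars the values of [chi] itself. *)
Theorem char_complete (g : CF) x0 : g x0 <> 0%C ->
  exists chi, cchar chi /\ exists x, (g ∗ chi) x <> 0%C.
Proof.
  intros Hg. set (phi := g ∗ g^~).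
  assert (Hphi : phi^~ = phi) by (apply Sq_star; now exists g).
  assert (Hphi0 : phi e0 <> 0%C).
  { unfold phi. rewrite conv_star_e0. pose proof (N_gt0 g x0 Hg).
    intros H0. apply RtoC_inj in H0. lra. }
  destruct (top_idempotent phi Hphi e0 Hphi0) as (mu & psi0 & Hmu & H1 & H2 & H3 & H0).
  destruct (minimal_idem_exists psi0) as (psi & Hi & Hp0 & Hpp & Hm); [now split|exact H0|].
  set (chi := (/ psi e0)%C ∙ psi).
  assert (Hmul : forall x y, chi (x ⊕ y) = (chi x * chi y)%C).
  { intros x y. destruct (minimal_idem_translate psi y Hi Hm) as (c & Hc).
    assert (Hx := f_equal (fun h : CF => h x) Hc). assert (He := f_equal (fun h : CF => h e0) Hc).
    simpl in Hx, He. replace (e0 ⊕ y) with y in He by agroup.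
    unfold chi; simpl. rewrite Hx, He. field. exact Hp0. }
  assert (Hone : chi e0 = 1%C) by (unfold chi; simpl; field; exact Hp0).
  assert (Hstar : chi^~ = chi).
  { unfold chi. rewrite star_scal. destruct Hi as [Hi1 Hi2]. rewrite Hi1. f_equal.
    rewrite Cinv_conj by exact Hp0. f_equal. rewrite <- star_e0, Hi1. reflexivity. }
  exists chi. split; [split; [exact Hmul|]|].
  (* [chi] is hermitian, so [chi (⊖ x)] is the conjugate of [chi x]. *)
  - intros x. rewrite <- Hone. replace e0 with (x ⊖ x) by agroup. rewrite Hmul. f_equal.
    assert (Hx := f_equal (fun h : CF => h x) Hstar).
    change (Cconj (chi (⊖ x)) = chi x) in Hx. rewrite <- Hx. apply Cconj_conj.
  - apply NNPP; intros Hn.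
    assert (Hz : g ∗ psi = RtoC 0 ∙ psi).
    { apply CF_ext; intros x. simpl. rewrite Cmult_0_l. apply NNPP; intros Hx. apply Hn.
      exists x. unfold chi. rewrite conv_scal_r. intros Hc.
      change ((/ psi e0 * (g ∗ psi) x)%C = 0%C) in Hc. apply Hx.
      change ((g ∗ psi) x = 0%C).
      replace ((g ∗ psi) x) with (psi e0 * (/ psi e0 * (g ∗ psi) x))%C by (field; exact Hp0).
      rewrite Hc. ring. }
    assert (Hmp : phi ∗ phi ∗ psi = RtoC mu ∙ psi).
    { rewrite <- Hpp, (conv_comm psi), conv_assoc, H3, conv_scal_l. reflexivity. }
    unfold phi in Hmp. rewrite (conv_comm g) in Hmp at 2.
    rewrite <- !conv_assoc, Hz, !conv_scal_r in Hmp.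
    apply (f_equal (fun h : CF => h e0)) in Hmp.
    change (RtoC 0 * (g ∗ (g^~ ∗ (g^~ ∗ psi))) e0 = RtoC mu * psi e0)%C in Hmp.
    apply Hp0. replace (psi e0) with (/ RtoC mu * (RtoC mu * psi e0))%C.
    + rewrite <- Hmp. ring.
    + field. intros H; apply RtoC_inj in H; lra.
Qed.

(** * Bump functions *)

Lemma nb_add V : nb V -> exists W, nb W /\ forall u v, W u -> W v -> V (u ⊕ v).
Proof.
  intros HV. destruct (nb_sub V HV) as (W1 & HW1 & H1). destruct (nb_sym W1 HW1) as (W & HW & H).
  exists W; split; [exact HW|]. intros u v Hu Hv.
  replace (u ⊕ v) with (u ⊖ (⊖ v)) by agroup. apply H1; now apply H.
Qed.

(** The chain of the Birkhoff-Kakutani construction. Choosing on the subtype of neighbourhoods lets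
    the step be iterated. *)
Lemma nb_chain V : nb V -> exists Vs : nat -> G -> Prop,
  (forall x, Vs O x -> V x) /\ (forall n, nb (Vs n)) /\
  (forall n u v, Vs (S n) u -> Vs (S n) v -> Vs n (u ⊕ v)).
Proof.
  intros HV.
  destruct (choice (fun V W : {V | nb V} => forall u v, proj1_sig W u -> proj1_sig W v ->
    proj1_sig V (u ⊕ v))) as (s & Hs).
  { intros [V' HV']. destruct (nb_add V' HV') as (W & HW & H). exists (exist _ W HW). exact H. }
  exists (fun n => proj1_sig (Nat.iter n s (exist _ V HV))). split; [auto|split].
  - intros n. apply proj2_sig.
  - intros n. apply Hs.
Qed.

Section Dyadic.
Variable Vs : nat -> G -> Prop.
Hypothesis Vs_nb : forall n, nb (Vs n).
Hypothesis Vs_add : forall n u v, Vs (S n) u -> Vs (S n) v -> Vs n (u ⊕ v).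

(* The set attached to the dyadic rational [k / 2^n]: the sum of the [Vs i] over the binary digits
   of [k / 2^n], and everything from [1] on. *)
Fixpoint D (n k : nat) (x : G) : Prop :=
  match n with
  | O => k = O -> x = e0
  | S m => if Nat.even k then D m (Nat.div2 k) x
           else exists y v, D m (Nat.div2 k) y /\ Vs (S m) v /\ x = y ⊕ v
  end.

Lemma D_even n j x : D (S n) (2 * j) x = D n j x.
Proof.
  unfold D; fold D. rewrite Nat.even_mul, Nat.div2_double. reflexivity.
Qed.

Lemma D_odd n j x : D (S n) (S (2 * j)) x = exists y v, D n j y /\ Vs (S n) v /\ x = y ⊕ v.
Proof.
  unfold D; fold D. rewrite Nat.even_succ, <- Nat.negb_even, Nat.even_mul, Nat.div2_succ_double.
  reflexivity.
Qed.

(** Binary addition of one in the last digit: a carry is the inclusion of [Vs (S n) + Vs (S n)] in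
    [Vs n]. *)
Lemma D_step n k x v : D n k x -> Vs n v -> D n (S k) (x ⊕ v).
Proof.
  revert k x v; induction n as [|n IH]; intros k x v Hx Hv; [simpl; discriminate|].
  destruct (Nat.Even_or_Odd k) as [[j ->]|[j ->]].
  - rewrite D_even in Hx. rewrite D_odd. now exists x, v.
  - replace (2 * j + 1)%nat with (S (2 * j)) in Hx by lia. rewrite D_odd in Hx.
    replace (S (2 * j + 1)) with (2 * S j)%nat by lia. rewrite D_even.
    destruct Hx as (y & w & Hy & Hw & ->).
    replace (y ⊕ w ⊕ v) with (y ⊕ (w ⊕ v)) by agroup. auto.
Qed.

Lemma D_mono n k k' x : (k <= k')%nat -> D n k x -> D n k' x.
Proof.
  intros Hk Hx. induction Hk as [|k' Hk IH]; [exact Hx|].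
  replace x with (x ⊕ e0) by agroup. apply D_step; [exact IH|apply Vs_nb].
Qed.

Lemma D_refine m n k x : D (m + n) (2 ^ m * k) x = D n k x.
Proof.
  induction m as [|m IH].
  - rewrite Nat.pow_0_r, Nat.mul_1_l. reflexivity.
  - replace (2 ^ S m * k)%nat with (2 * (2 ^ m * k))%nat by (simpl; lia).
    change (S m + n)%nat with (S (m + n)). rewrite D_even. exact IH.
Qed.

Definition dyadic (x : G) (s : R) : Prop := exists n k, D n k x /\ s = INR k / 2 ^ n.

Lemma pow2_pos n : 0 < 2 ^ n.
Proof. apply pow_lt; lra. Qed.

Lemma dyadic_ge0 x s : dyadic x s -> 0 <= s.
Proof.
  intros (n & k & _ & ->). apply Rdiv_le_0_compat; [apply pos_INR|apply pow2_pos].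
Qed.

Lemma dyadic_e0 : dyadic e0 0.
Proof. exists O, O. split; [now intros _|simpl; field]. Qed.

Lemma dyadic_1 x : dyadic x 1.
Proof. exists O, 1%nat. split; [discriminate|simpl; field]. Qed.

Lemma dyadic_half x s : dyadic x s -> s < 1 / 2 -> Vs 1%nat x.
Proof.
  intros (n & k & Hx & ->) Hlt.
  assert (HD : D 1 1 x -> Vs 1%nat x).
  { intros (y & v & Hy & Hv & ->). rewrite (Hy eq_refl). now rewrite (g0l G (proj1 HG)). }
  apply HD. destruct n as [|n].
  - simpl in Hlt. assert (Hk : k = O).
    { destruct k; [reflexivity|]. rewrite S_INR in Hlt. pose proof (pos_INR k). lra. }
    subst k. rewrite (Hx eq_refl). exists e0, e0. split; [now intros _|split; [apply Vs_nb|agroup]].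
  - rewrite <- (D_refine n). replace (n + 1)%nat with (S n) by lia.
    apply (D_mono _ k); [|exact Hx]. apply INR_le. rewrite Nat.mul_1_r, pow_INR. simpl INR.
    apply Rlt_le. pose proof (pow2_pos n) as Hp. simpl in Hlt.
    apply (Rmult_lt_compat_r (2 * 2 ^ n)) in Hlt; [|lra].
    replace (INR k / (2 * 2 ^ n) * (2 * 2 ^ n)) with (INR k) in Hlt by (field; lra).
    replace (1 + 1) with 2 by ring. lra.
Qed.

(** One unit [1 / 2^n] pays for rounding [s] up to denominator [2^n], the other for adding [v]. *)
Lemma dyadic_shift n x v s : Vs n v -> dyadic x s -> exists t, dyadic (x ⊕ v) t /\ t <= s + 2 / 2 ^ n.
Proof.
  intros Hv (m & k & Hx & ->).
  set (K := (2 ^ n * k)%nat). set (q := (K / 2 ^ m)%nat).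
  assert (H2m : (2 ^ m <> 0)%nat) by (apply Nat.pow_nonzero; lia).
  assert (Hq1 : (K <= 2 ^ m * S q)%nat).
  { unfold q. pose proof (Nat.mul_succ_div_gt K (2 ^ m) H2m). lia. }
  assert (Hq2 : (2 ^ m * q <= K)%nat) by now apply Nat.Div0.mul_div_le.
  assert (HD : D n (S q) x).
  { rewrite <- (D_refine m), Nat.add_comm. apply (D_mono _ K); [exact Hq1|].
    unfold K. rewrite D_refine. exact Hx. }
  exists (INR (S (S q)) / 2 ^ n). split.
  - exists n, (S (S q)). split; [|reflexivity]. now apply D_step.
  - rewrite !S_INR. pose proof (pow2_pos n). pose proof (pow2_pos m).
    apply le_INR in Hq2. unfold K in Hq2. rewrite !mult_INR, !pow_INR in Hq2.
    simpl INR in Hq2. replace (1 + 1) with 2 in Hq2 by ring.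
    assert (INR q / 2 ^ n <= INR k / 2 ^ m).
    { apply (Rmult_le_reg_r (2 ^ m * 2 ^ n)); [nra|].
      replace (INR q / 2 ^ n * (2 ^ m * 2 ^ n)) with (2 ^ m * INR q) by (field; lra).
      replace (INR k / 2 ^ m * (2 ^ m * 2 ^ n)) with (2 ^ n * INR k) by (field; lra). exact Hq2. }
    replace ((INR q + 1 + 1) / 2 ^ n) with (INR q / 2 ^ n + 2 / 2 ^ n) by (field; lra). lra.
Qed.

End Dyadic.

(** Urysohn's function [f x] is the infimum of the dyadic numbers attached to [x]; [dyadic_shift]
    makes it uniformly continuous. It is at most [0] at [e0], and [f x < 1 / 2] forces [x] into
    [Vs 1], so the cut-off at [1 / 2] gives the bump. *)
Lemma bump_exists V : nb V -> exists g : G -> R,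
  rcont g /\ (forall x, 0 <= g x) /\ 0 < g e0 /\ (forall x, 0 < g x -> V x).
Proof.
  intros HV. destruct (nb_chain V HV) as (Vs & HVs0 & HVs & Hadd).
  assert (Hf : forall x, exists t, (forall s, dyadic Vs x s -> t <= s) /\
    forall eps, 0 < eps -> exists s, dyadic Vs x s /\ s < t + eps).
  { intros x. apply R_inf; [|exists 1; apply dyadic_1].
    exists 0. intros s. apply dyadic_ge0. }
  destruct (choice _ Hf) as (f & Hf').
  assert (Hshift : forall n x v, Vs n v -> f (x ⊕ v) <= f x + 2 / 2 ^ n).
  { intros n x v Hv. apply le_epsilon. intros eps He.
    destruct (proj2 (Hf' x) eps He) as (s & Hs & Hse).
    destruct (dyadic_shift Vs HVs Hadd n x v s Hv Hs) as (t & Ht & Hts).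
    pose proof (proj1 (Hf' (x ⊕ v)) t Ht). lra. }
  exists (fun x => Rmax 0 (1 / 2 - f x)). split; [|split; [|split]].
  - intros eps He.
    assert (exists n, 2 / 2 ^ n <= eps) as (n & Hn).
    { destruct (pow_lt_1_zero (/ 2)) with (y := eps / 2) as (n & Hn).
      - rewrite Rabs_right; lra.
      - lra.
      - exists n. specialize (Hn n (le_n n)). rewrite pow_inv in Hn.
        apply Rabs_def2 in Hn. unfold Rdiv. lra. }
    destruct (nb_sym (Vs n) (HVs n)) as (W & HW & H).
    exists W; split; [exact HW|]. intros x y Hxy. apply H in Hxy as [H1 H2].
    assert (Hx : f x <= f y + 2 / 2 ^ n).
    { replace x with (y ⊕ (x ⊖ y)) by agroup. now apply Hshift. }
    assert (Hy : f y <= f x + 2 / 2 ^ n).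
    { replace y with (x ⊖ (x ⊖ y)) at 1 by agroup. now apply Hshift. }
    apply Rabs_le. unfold Rmax. repeat destruct Rle_dec; lra.
  - intros x. apply Rmax_l.
  - apply Rlt_le_trans with (1 / 2 - f e0); [|apply Rmax_r].
    pose proof (proj1 (Hf' e0) 0 (dyadic_e0 Vs)). lra.
  - intros x Hx. assert (Hfx : f x < 1 / 2).
    { unfold Rmax in Hx. destruct Rle_dec; lra. }
    destruct (proj2 (Hf' x) (1 / 2 - f x)) as (s & Hs & Hse); [lra|].
    apply HVs0. replace x with (x ⊕ e0) by agroup. apply Hadd; [|apply HVs].
    apply (dyadic_half Vs HVs Hadd x s Hs). lra.
Qed.

(** * Nontrivial characters and roots of characters *)

Definition real_CF (g : G -> R) (Hg : rcont g) : CF :=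
  mkCF (fun x => RtoC (g x)) (conj Hg (rcont_const 0)).

(** A bump separating [a] from [0], minus its mean, is a nonzero function orthogonal to the
    constants. A character correlated with it cannot be trivial. *)
Lemma nontrivial_char : nontrivial G -> exists chi, cchar chi /\ exists x, chi x <> 1%C.
Proof.
  intros [a Ha]. destruct (nb_separates a Ha) as (V & HV & HVa).
  destruct (bump_exists V HV) as (g & Hg & Hg0 & Hge & HgV).
  set (f := real_CF g Hg ∔ mkCF _ (ccont_const (RtoC (- M g)))).
  assert (Hf : exists x, f x <> 0%C).
  { apply NNPP; intros Hn.
    assert (H : forall x, g x = M g).
    { intros x. apply NNPP; intros Hx. apply Hn. exists x. intros H. apply Hx.
      apply (f_equal Re) in H. simpl in H. lra. }
    apply HVa, HgV. rewrite H, <- (H e0). exact Hge. }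
  destruct Hf as (x0 & Hx0). destruct (char_complete f x0 Hx0) as (chi & Hchi & x & Hx).
  exists chi; split; [exact Hchi|]. apply NNPP; intros Hn. apply Hx.
  assert (H1 : forall y, chi y = 1%C) by (intros y; apply NNPP; intros Hy; apply Hn; now exists y).
  change (Mc (fun y => f (x ⊖ y) * chi y)%C = 0%C).
  replace (fun y => f (x ⊖ y) * chi y)%C with (fun y => f (x ⊖ y))
    by (apply functional_extensionality; intros y; rewrite H1; ring).
  rewrite (Mc_refl f x (cf_cont f)). apply C_ext; simpl.
  - rewrite (M_add g (fun _ => - M g)), M_const; auto using rcont_const. ring.
  - rewrite Rplus_0_l. apply M_const.
Qed.

Lemma cchar_e0 chi : cchar chi -> chi e0 = 1%C.
Proof.
  intros [H1 H2]. pose proof (H2 e0) as H. pose proof (H1 e0 e0) as H0.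
  rewrite (g0 G (proj1 HG)) in H0.
  rewrite <- H. rewrite H0 at 2.
  rewrite <- Cmult_assoc, H. ring.
Qed.

Lemma cchar_nsmul chi n x : cchar chi -> chi (nsmul G n x) = (chi x ^ n)%C.
Proof.
  intros H. induction n as [|n IH]; simpl; [now apply cchar_e0|].
  rewrite (proj1 H), IH. reflexivity.
Qed.

Lemma nsmul_e0 n : nsmul G n e0 = e0.
Proof. induction n as [|n IH]; simpl; [reflexivity|]. rewrite IH. agroup. Qed.

Lemma nsmul_add n x y : nsmul G n (x ⊕ y) = nsmul G n x ⊕ nsmul G n y.
Proof. induction n as [|n IH]; simpl; [agroup|]. rewrite IH. agroup. Qed.

Lemma nsmul_opp n x : nsmul G n (⊖ x) = ⊖ nsmul G n x.
Proof. induction n as [|n IH]; simpl; [agroup|]. rewrite IH. agroup. Qed.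

Lemma nb_nsmul n V : nb V -> exists W, nb W /\ forall u, W u -> V (nsmul G n u).
Proof.
  revert V; induction n as [|n IH]; intros V HV.
  - exists V; split; [exact HV|]. intros u _. apply HV.
  - destruct (nb_add V HV) as (V' & HV' & H). destruct (IH V' HV') as (W & HW & H').
    exists (fun x => V' x /\ W x); split; [now apply nb_inter|].
    intros u [Hu1 Hu2]. simpl. auto.
Qed.

Lemma jcont_add_nsmul g n : rcont g -> jcont (fun x y => g (x ⊕ nsmul G n y)).
Proof.
  intros Hg eps He. destruct (Hg eps He) as (V & HV & H).
  destruct (nb_add V HV) as (V' & HV' & H'). destruct (nb_nsmul n V' HV') as (W & HW & H'').
  exists (fun x => V' x /\ W x); split; [now apply nb_inter|].
  intros x x' y y' [Hx _] [_ Hy]. apply H.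
  replace (x ⊕ nsmul G n y ⊖ (x' ⊕ nsmul G n y')) with ((x ⊖ x') ⊕ nsmul G n (y ⊖ y')).
  - auto.
  - rewrite nsmul_add, nsmul_opp. agroup.
Qed.

(* As [y |-> n y] is injective and [G] is compact, [n y] can only be small if [y] is small. *)
Lemma nsmul_small_re (gam : CF) n : (forall x, nsmul G n x = e0 -> x = e0) -> cchar gam ->
  exists W, nb W /\ forall y, W (nsmul G n y) -> 1 / 2 < Re (gam y).
Proof.
  intros Hinj Hgam.
  set (Q := fun U V : G -> Prop => forall y, U y -> V (nsmul G n y) -> 1 / 2 < Re (gam y)).
  destruct (compact_cover (fun U => exists V, nb V /\ Q U V)) as (l & Hl1 & Hl2).
  - intros y. destruct (Rlt_le_dec (1 / 2) (Re (gam y))) as [Hy|Hy].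
    + destruct (rcont_pointwise _ (proj1 (cf_cont gam)) y (Re (gam y) - 1 / 2)) as (U & HU & Uy & H); [lra|].
      exists U; repeat split; auto. exists (fun _ => True); split; [apply nb_full|].
      intros z Uz _. apply H in Uz. apply Rabs_def2 in Uz. lra.
    + assert (Hny : nsmul G n y <> e0).
      { intros H. apply Hinj in H. subst y. rewrite cchar_e0 in Hy by exact Hgam. simpl in Hy. lra. }
      destruct (nb_separates _ Hny) as (V0 & HV0 & Hn).
      destruct (nb_sub V0 HV0) as (W & HW & HWV). destruct (nb_nsmul n W HW) as (W' & HW' & H').
      pose proof HG as (_ & _ & Hs & _).
      destruct (Hs y y W' (proj1 HW')) as (A & B & HA & HB & Ay & By & HAB).
      { replace (y ⊖ y) with e0 by agroup. apply HW'. }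
      exists A; repeat split; auto. exists W; split; [exact HW|].
      intros z Az Wz. exfalso. apply Hn.
      replace (nsmul G n y) with (nsmul G n z ⊖ nsmul G n (z ⊖ y)) by (rewrite nsmul_add, nsmul_opp; agroup).
      auto.
  - destruct (nb_finite_inter _ Q l) as (W & HW & H).
    + intros U V V' H HV y Uy V'y. auto.
    + exact Hl1.
    + exists W; split; [exact HW|]. intros y Hy. destruct (Hl2 y) as (U & HU & Uy).
      exact (H U HU y Uy Hy).
Qed.

(* Averaging a bump against [gam] along the multiples [n y] gives [h <> 0] with
   [h (x + n z) = gam z * h x]; any character correlated with [h] is then an [n]-th root of [gam]. *)
Theorem char_root (gam : CF) n : (forall x, nsmul G n x = e0 -> x = e0) -> cchar gam ->
  exists chi, cchar chi /\ forall x, gam x = (chi x ^ n)%C.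
Proof.
  intros Hinj Hgam. destruct (nsmul_small_re gam n Hinj Hgam) as (W & HW & HWre).
  destruct (bump_exists W HW) as (g & Hg & Hg0 & Hge & HgW).
  set (F := fun x y => (RtoC (g (x ⊕ nsmul G n y)) * Cconj (gam y))%C).
  assert (HF : cjcont F).
  { apply (cjcont_mul (fun x y => RtoC (g (x ⊕ nsmul G n y))) (fun _ y => Cconj (gam y))).
    - split; [now apply (jcont_add_nsmul g n)|]. apply (jcont_fst (fun _ => 0)), rcont_const.
    - apply (cjcont_snd (fun y => Cconj (gam y))), ccont_conj, cf_cont. }
  set (h := mkCF (fun x => Mc (F x)) (ccont_Mc F HF)).
  assert (Hh : forall z, ctr (nsmul G n z) h = gam z ∙ h).
  { intros z. apply CF_ext; intros x.
    change (Mc (F (x ⊕ nsmul G n z)) = (gam z * Mc (F x))%C).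
    rewrite <- Mc_scal by now apply cjcont_row.
    rewrite <- (Mc_tr (fun y => gam z * F x y)%C z) by now apply ccont_scal, cjcont_row.
    f_equal. apply functional_extensionality; intros y. unfold F.
    rewrite nsmul_add. replace (x ⊕ (nsmul G n y ⊕ nsmul G n z)) with (x ⊕ nsmul G n z ⊕ nsmul G n y) by agroup.
    rewrite (proj1 Hgam), Cmult_conj.
    replace (gam z * (RtoC (g (x ⊕ nsmul G n z ⊕ nsmul G n y)) * (Cconj (gam y) * Cconj (gam z))))%C
      with ((gam z * Cconj (gam z)) * (RtoC (g (x ⊕ nsmul G n z ⊕ nsmul G n y)) * Cconj (gam y)))%C by ring.
    rewrite (proj2 Hgam). ring. }
  assert (Hh0 : h e0 <> 0%C).
  { intros H. apply (f_equal Re) in H.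
    change (M (fun y => Re (F e0 y)) = 0) in H.
    assert (HRe : forall y, Re (F e0 y) = g (nsmul G n y) * Re (gam y)).
    { intros y. unfold F. rewrite (g0l G (proj1 HG)), re_scal_l, re_conj. reflexivity. }
    (* The integrand [g (n y) * Re (gam y)] is nonnegative, as [Re (gam y) > 1 / 2] wherever the
       bump is nonzero. *)
    assert (0 < M (fun y => Re (F e0 y))); [|lra].
    apply (M_gt0 _ e0).
    - apply (proj1 (cjcont_row F e0 HF)).
    - intros y. rewrite HRe. destruct (Hg0 (nsmul G n y)) as [Hp|<-]; [|lra].
      specialize (HWre y (HgW _ Hp)). nra.
    - rewrite HRe, cchar_e0 by exact Hgam. simpl.
      rewrite nsmul_e0. lra. }
  destruct (char_complete h e0 Hh0) as (chi & Hchi & x & Hx).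
  exists chi; split; [exact Hchi|]. intros z.
  rewrite <- cchar_nsmul by exact Hchi. set (a := nsmul G n z).
  (* Translation by [n z] can act on either factor of [h ∗ chi]; comparing the two scalars at a
     point where the convolution is nonzero gives the root. *)
  assert (H1 : ctr a (h ∗ chi) = gam z ∙ (h ∗ chi)).
  { rewrite <- ctr_conv. unfold a. rewrite Hh, conv_scal_l. reflexivity. }
  assert (H2 : ctr a (h ∗ chi) = chi a ∙ (h ∗ chi)).
  { rewrite <- ctr_conv_r, <- conv_scal_r. f_equal. apply CF_ext; intros y. simpl.
    rewrite (proj1 Hchi). ring. }
  rewrite H1 in H2. apply (f_equal (fun f : CF => f x)) in H2.
  change (gam z * (h ∗ chi) x = chi a * (h ∗ chi) x)%C in H2.
  replace (gam z) with ((gam z * (h ∗ chi) x) / (h ∗ chi) x)%C by (field; exact Hx).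
  rewrite H2. field. exact Hx.
Qed.

(** * The dual group *)

Definition dval (gam : dual G) : G -> C := proj1_sig gam.

Lemma CF_of_dual (gam : dual G) : exists chi, cchar chi /\ forall x, chi x = dval gam x.
Proof.
  destruct gam as [g (Hn & Hm & Hc)]; simpl.
  (* [Cdist2] is a squared distance, so it receives the tolerance [eps * eps]. *)
  assert (Hsq : forall a b eps, 0 < eps -> a * a + b * b < eps * eps -> Rabs a < eps /\ Rabs b < eps).
  { intros a b eps He H. split; apply Rabs_def1; nra. }
  assert (Hcont : ccont g).
  { split; apply rcont_of_pointwise; intros x eps He;
      destruct (Hc x (eps * eps)) as (U & HU & Ux & H); try nra;
      exists U; repeat split; auto; intros y Uy; apply H in Uy;
      now apply (Hsq _ _ eps He) in Uy. }
  exists (mkCF g Hcont). split; [split|]; simpl; auto.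
  intros x. specialize (Hn x). unfold Cnorm2 in Hn. apply C_ext; simpl; [lra|ring].
Qed.

Lemma dual_of_CF (chi : CF) : cchar chi -> exists gam : dual G, forall x, dval gam x = chi x.
Proof.
  intros [Hm Hn]. assert (H : is_character G chi).
  { split; [|split].
    - intros x. specialize (Hn x). apply (f_equal Re) in Hn. simpl in Hn. unfold Cnorm2. lra.
    - exact Hm.
    (* With [d <= 1] the squared distance is at most [2 d^2 <= 2 d <= eps / 2]. *)
    - intros x eps He. set (d := Rmin 1 (eps / 4)).
      assert (Hd : 0 < d) by (apply Rmin_glb_lt; lra).
      assert (Hd1 : d <= 1) by apply Rmin_l. assert (Hd2 : d <= eps / 4) by apply Rmin_r.
      destruct (rcont_pointwise _ (proj1 (cf_cont chi)) x d Hd) as (U & HU & Ux & H1).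
      destruct (rcont_pointwise _ (proj2 (cf_cont chi)) x d Hd) as (V & HV & Vx & H2).
      exists (fun y => U y /\ V y). split; [|split; [now split|]].
      + pose proof HG as (_ & (_ & _ & Hi & _) & _). auto.
      + intros y [Uy Vy]. apply H1 in Uy. apply H2 in Vy. unfold Re, Im in *.
        apply Rabs_def2 in Uy, Vy. unfold Cdist2, Cnorm2. simpl. nra. }
  exists (exist _ _ H). reflexivity.
Qed.

Lemma dual_root (gam : dual G) n : torsion_free G -> (0 < n)%nat ->
  exists chi : dual G, forall x, dval gam x = (dval chi x ^ n)%C.
Proof.
  intros Htf Hn. destruct (CF_of_dual gam) as (g & Hg & Hgg).
  destruct (char_root g n) as (c & Hc & Hcg); [intros x Hx; exact (Htf n x Hn Hx)|exact Hg|].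
  destruct (dual_of_CF c Hc) as (chi & Hchi).
  exists chi. intros x. now rewrite <- Hgg, Hcg, Hchi.
Qed.

Lemma dual_nontrivial : nontrivial G -> exists (gam : dual G) x, dval gam x <> 1%C.
Proof.
  intros Hnt. destruct (nontrivial_char Hnt) as (c & Hc & x & Hx).
  destruct (dual_of_CF c Hc) as (chi & Hchi). exists chi, x. now rewrite Hchi.
Qed.

Lemma dual_mul_exists (a b : dual G) :
  exists c : dual G, forall x, dval c x = (dval a x * dval b x)%C.
Proof.
  destruct (CF_of_dual a) as (f & [Hf1 Hf2] & Hf). destruct (CF_of_dual b) as (g & [Hg1 Hg2] & Hg).
  destruct (dual_of_CF (mkCF _ (ccont_mul f g (cf_cont f) (cf_cont g)))) as (c & Hc).
  - split; simpl.
    + intros x y. rewrite Hf1, Hg1. ring.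
    + intros x. rewrite Cmult_conj.
      replace (f x * g x * (Cconj (f x) * Cconj (g x)))%C
        with ((f x * Cconj (f x)) * (g x * Cconj (g x)))%C by ring.
      rewrite Hf2, Hg2. ring.
  - exists c. intros x. rewrite Hc, <- Hf, <- Hg. reflexivity.
Qed.

Lemma dual_inv_exists (a : dual G) : exists c : dual G,
  forall x, (dval a x * dval c x = 1)%C.
Proof.
  destruct (CF_of_dual a) as (f & [Hf1 Hf2] & Hf).
  destruct (dual_of_CF (mkCF _ (ccont_conj f (cf_cont f)))) as (c & Hc).
  - split; simpl.
    + intros x y. rewrite Hf1. apply Cmult_conj.
    + intros x. rewrite Cconj_conj, Cmult_comm. apply Hf2.
  - exists c. intros x. rewrite Hc, <- Hf. apply Hf2.
Qed.

Lemma dual_pow_exists (a : dual G) n : exists c : dual G,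
  forall x, dval c x = (dval a x ^ n)%C.
Proof.
  induction n as [|n (c & Hc)].
  - destruct (dual_inv_exists a) as (b & Hb). destruct (dual_mul_exists a b) as (c & Hc).
    exists c. intros x. rewrite Hc, Hb. reflexivity.
  - destruct (dual_mul_exists a c) as (d & Hd). exists d. intros x. rewrite Hd, Hc. reflexivity.
Qed.

(** * Subgroups of finite index *)

Lemma subgroup_pow H (a b : dual G) n : is_subgroup G H -> H a ->
  (forall x, dval b x = (dval a x ^ n)%C) -> H b.
Proof.
  intros HH Ha. revert b; induction n as [|n IH]; intros b Hb.
  - apply HH. exact Hb.
  - destruct (dual_pow_exists a n) as (c & Hc).
    apply (proj1 (proj2 HH) a c b Ha (IH c Hc)).
    intros x. rewrite Hb. simpl. now rewrite Hc.
Qed.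

Lemma pigeonhole (A : Type) (c : nat -> A) (l : list A) : (forall i, In (c i) l) ->
  exists i j, (i < j <= length l)%nat /\ c i = c j.
Proof.
  intros Hc. apply NNPP; intros Hn.
  assert (Hnd : NoDup (map c (seq 0 (S (length l))))).
  { apply NoDup_map_NoDup_ForallPairs; [|apply seq_NoDup].
    intros i j Hi Hj Hij. apply in_seq in Hi, Hj.
    destruct (Nat.lt_trichotomy i j) as [Hlt|[Heq|Hlt]]; [|exact Heq|]; exfalso; apply Hn.
    - exists i, j. split; [lia|exact Hij].
    - exists j, i. split; [lia|now symmetry]. }
  assert (Hincl : incl (map c (seq 0 (S (length l)))) l).
  { intros y Hy. apply in_map_iff in Hy as (i & <- & _). apply Hc. }
  pose proof (NoDup_incl_length Hnd Hincl) as Hlen.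
  rewrite length_map, length_seq in Hlen. lia.
Qed.

Lemma fact_multiple d n : (0 < d <= n)%nat -> exists q, fact n = (d * q)%nat.
Proof.
  induction n as [|n IH]; intros Hd; [lia|].
  destruct (Nat.eq_dec d (S n)) as [->|Hne].
  - exists (fact n). reflexivity.
  - destruct IH as (q & Hq); [lia|]. exists (q * S n)%nat.
    change (S n * fact n = d * (q * S n))%nat. rewrite Hq. ring.
Qed.

(** Let [chi] be a root of [gam] of order [fact (length l)]. Two of the powers
    [chi^0, ..., chi^(length l)] share a listed coset representative, so [chi^(j - i)] lies in [H].
    As [j - i] divides the factorial, [gam] is a power of an element of [H]. *)
Lemma finite_index_full H (gam : dual G) : torsion_free G -> is_subgroup G H -> finite_index G H -> H gam.
Proof.
  intros Htf HH (l & Hl).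
  destruct (dual_root gam (fact (length l)) Htf (lt_O_fact _)) as (chi & Hchi).
  destruct (choice _ (dual_pow_exists chi)) as (p & Hp).
  destruct (choice (fun i g => exists h, In g l /\ H h /\ dual_mul_rel G g h (p i))) as (c & Hc).
  { intros i. destruct (Hl (p i)) as (g & h & Hgh). now exists g, h. }
  destruct (pigeonhole _ c l) as (i & j & Hij & Heq).
  { intros i. now destruct (Hc i) as (h & Hin & _). }
  destruct (Hc i) as (hi & _ & Hhi & Hmi). destruct (Hc j) as (hj & _ & Hhj & Hmj).
  rewrite <- Heq in Hmj.
  destruct (dual_inv_exists hi) as (hi' & Hhi').
  assert (Hinv : H hi').
  { apply (proj2 (proj2 HH) hi hi' Hhi). intros d Hd x. rewrite Hd. apply Hhi'. }
  assert (Hd : H (p (j - i)%nat)).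
  { apply (proj1 (proj2 HH) hj hi' _ Hhj Hinv). intros x.
    change (dval (p (j - i)%nat) x = (dval hj x * dval hi' x)%C).
    specialize (Hmi x). specialize (Hmj x). specialize (Hhi' x).
    change (dval (p i) x = (dval (c i) x * dval hi x)%C) in Hmi.
    change (dval (p j) x = (dval (c i) x * dval hj x)%C) in Hmj.
    rewrite Hp in Hmi, Hmj |- *.
    replace j with (i + (j - i))%nat in Hmj by lia. rewrite Cpow_add_r, Hmi in Hmj.
    set (w := (dval chi x ^ (j - i))%C) in *.
    destruct (CF_of_dual (c i)) as (g & [_ Hg] & Hgc). specialize (Hg x). rewrite Hgc in Hg.
    set (z := dval (c i) x : C) in *. set (a := dval hi x : C) in *.
    set (b := dval hj x : C) in *. set (a' := dval hi' x : C) in *.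
    replace w with ((z * Cconj z) * (a * a') * w)%C by (rewrite Hg, Hhi'; ring).
    replace (z * Cconj z * (a * a') * w)%C with ((z * a * w) * (Cconj z * a'))%C by ring.
    rewrite Hmj. replace (z * b * (Cconj z * a'))%C with ((z * Cconj z) * (b * a'))%C by ring.
    rewrite Hg. ring. }
  destruct (fact_multiple (j - i) (length l)) as (q & Hq); [lia|].
  apply (subgroup_pow H (p (j - i)%nat) gam q HH Hd).
  intros x. rewrite Hchi, Hq, Hp, Cpow_mult_r. reflexivity.
Qed.

(** * Trigonometric polynomials vanishing on a finite set *)

Definition tval (p : list (Defs.C * G)) (gam : dual G) : C := trig_eval G p gam.

Lemma tval_cons (c : C) y p gam : tval ((c, y) :: p) gam = (c * dval gam y + tval p gam)%C.
Proof. reflexivity. Qed.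

Lemma tval_app p q gam : tval (p ++ q) gam = (tval p gam + tval q gam)%C.
Proof.
  induction p as [|[c y] p IH].
  - change (tval q gam = (0 + tval q gam)%C). ring.
  - rewrite <- app_comm_cons, !tval_cons, IH. ring.
Qed.

(* The product is a polynomial in [gam x], hence a trigonometric polynomial in [gam]. *)
Lemma trig_product (x : G) (l : list (dual G)) :
  exists p, forall gam : dual G, tval p gam =
    fold_right (fun g acc => (dval gam x - dval g x) * acc)%C 1%C l.
Proof.
  induction l as [|g l (p & Hp)].
  - exists [(Defs.C1, e0)]. intros gam. change ((1 * dval gam e0 + 0)%C = 1%C).
    destruct (CF_of_dual gam) as (f & Hf & Hfg). rewrite <- Hfg, cchar_e0 by exact Hf. ring.
  (* Multiplication by [gam x] shifts the points by [x]; multiplication by [- g x] scales the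
     coefficients. *)
  - exists (map (fun cy => (fst cy, snd cy ⊕ x)) p ++
      map (fun cy => (Cmult (- dval g x) (fst cy), snd cy)) p).
    intros gam. simpl. rewrite <- Hp, tval_app. clear Hp.
    destruct (CF_of_dual gam) as (f & [Hf _] & Hfg).
    induction p as [|[c y] p IH].
    + change ((0 + 0)%C = ((dval gam x - dval g x) * 0)%C). ring.
    + simpl map. rewrite !tval_cons, Cmult_plus_distr_l, <- IH, <- !Hfg, Hf.
      simpl fst. simpl snd. ring.
Qed.

(** If the product polynomial vanished identically, every character would take at [x] one of the
    finitely many values [g x]. Applied to the powers of a root of [gam] of factorial order, this
    gives [chi x ^ (j - i) = 1], hence [gam x = 1], against the choice of [x]. *)
Lemma finite_not_spd (K : dual G -> Prop) : torsion_free G -> nontrivial G -> finite_subset G K ->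
  ~ strictly_positive_definite G K.
Proof.
  intros Htf Hnt (l & Hl) Hspd.
  destruct (dual_nontrivial Hnt) as (gam & x & Hx).
  destruct (trig_product x l) as (p & Hp).
  assert (Hval : forall chi : dual G, exists g, In g l /\ dval g x = dval chi x).
  { intros chi.
    assert (Hz : tval p chi = 0%C).
    { apply Hspd. clear chi. intros chi Hchi. apply Hl in Hchi. fold (tval p chi). rewrite Hp.
      clear - Hchi. induction l as [|g l IH]; [destruct Hchi|].
      simpl. destruct Hchi as [->|Hchi].
      - change (((dval chi x - dval chi x) *
          fold_right (fun g acc => (dval chi x - dval g x) * acc) 1 l)%C = 0%C). ring.
      - rewrite (IH Hchi). change ((dval chi x - dval g x) * 0 = 0)%C. ring. }
    rewrite Hp in Hz. clear - Hz. induction l as [|g l IH].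
    - simpl in Hz. apply (f_equal fst) in Hz. simpl in Hz. lra.
    - simpl in Hz. destruct (classic (dval g x = dval chi x)) as [H|H].
      + exists g; split; [now left|exact H].
      + destruct IH as (g' & Hg' & H').
        * apply NNPP; intros Hn. apply (Cmult_neq_0 (dval chi x - dval g x)) in Hz; auto.
          intros H0. apply H. symmetry.
          change ((dval chi x : C) = (dval g x : C)).
          replace (dval chi x : C) with (dval chi x - dval g x + dval g x)%C by ring.
          rewrite H0. ring.
        * exists g'; split; [now right|exact H']. }
  destruct (dual_root gam (fact (length l)) Htf (lt_O_fact _)) as (chi & Hchi).
  destruct (choice _ (dual_pow_exists chi)) as (q & Hq).
  destruct (choice _ (fun i => Hval (q i))) as (c & Hc).
  destruct (pigeonhole _ c l) as (i & j & Hij & Heq); [intros i; apply Hc|].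
  assert (Hpow : (dval chi x ^ i = dval chi x ^ j)%C).
  { rewrite <- !Hq, <- (proj2 (Hc i)), <- (proj2 (Hc j)), Heq. reflexivity. }
  assert (Hd : (dval chi x ^ (j - i) = 1)%C).
  { destruct (CF_of_dual (q i)) as (f & [_ Hf] & Hfq). specialize (Hf x). rewrite Hfq, Hq in Hf.
    replace j with (i + (j - i))%nat in Hpow at 1 by lia. rewrite Cpow_add_r in Hpow.
    set (z := (dval chi x ^ i)%C) in *. set (w := (dval chi x ^ (j - i))%C) in *.
    replace w with ((z * Cconj z) * w)%C by (rewrite Hf; ring).
    replace (z * Cconj z * w)%C with ((z * w) * Cconj z)%C by ring.
    rewrite <- Hpow. exact Hf. }
  destruct (fact_multiple (j - i) (length l)) as (r & Hr); [lia|].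
  apply Hx. rewrite Hchi, Hr, Cpow_mult_r, Hd. clear. induction r as [|r IH]; simpl; [reflexivity|].
  rewrite IH. ring.
Qed.

End CompactGroup.

Theorem theorem2p9 (G : TopAbGroup)
  (HG : is_compact_abelian_group G) (Htf : torsion_free G) (Hnt : nontrivial G) :
  (forall K : dual G -> Prop, (exists gam, K gam) -> ubiquitous G K) /\
  (forall K : dual G -> Prop, finite_subset G K -> ~ strictly_positive_definite G K).
Proof.
  split.
  - intros K [c Hc] H HH Hfi gam.
    destruct (dual_inv_exists G HG gam) as (g' & Hg').
    destruct (dual_mul_exists G HG g' c) as (h & Hh).
    (* [H] is the whole dual, so the quotient of any [c] in [K] by [gam] belongs to it. *)
    exists h, c. split; [now apply finite_index_full|split; [|exact Hc]].
    intros x. change (dval G c x = (dval G gam x * dval G h x)%C).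
    rewrite Hh, Cmult_assoc, Hg'. ring.
  - intros K HK. now apply finite_not_spd.
Qed.
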